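(* Let $K$ be a number field, let $p_1,p_2,p_3,\ldots$ be a sequence of positive prime numbers, and for $i=1,2,3,\ldots$ let $D_i$ be a $p_i$-Eisenstein polynomial in $\mathbb{Z}[x]$. Denote $d_i=\deg D_i$ and let $\alpha_i\in\overline{\mathbb{Q}}$ be any root of $D_i$. Moreover suppose that $p_i\nmid \Delta_{\mathbb{Q}(\alpha_j)}$ for all $1\leq j<i$, and that $p_i^{1/d_i}\longrightarrow \infty$ as $i$ tends to infinity. Then the field $K(\alpha_1,\alpha_2,\alpha_3,\ldots)$ has the Northcott property.
   Context: All fields lie in a fixed algebraic closure $\overline{\mathbb{Q}}$ of $\mathbb{Q}$. $H(\cdot)$ denotes the non-logarithmic absolute Weil height on $\overline{\mathbb{Q}}$: for $\alpha$ in a number field $F$, $H(\alpha)=\prod_v \max\{1,|\alpha|_v\}^{[F_v:\mathbb{Q}_v]/[F:\mathbb{Q}]}$, the product over all places $v$ of $F$, with $|\cdot|_v$ extending the usual absolute values of $\mathbb{Q}$. A subset $\mathcal{A}\subseteq\overline{\mathbb{Q}}$ has the Northcott property (property $(N)$) if for each positive real $X$ there are only finitely many $\alpha\in\mathcal{A}$ with $H(\alpha)\le X$. For a prime number $p$, a $p$-Eisenstein polynomial in $\mathbb{Z}[x]$ is a monic polynomial $x^d+a_1x^{d-1}+\cdots+a_d\in\mathbb{Z}[x]$ with $p\mid a_j$ for $1\le j\le d$ and $p^2\nmid a_d$. $\Delta_F$ denotes the absolute discriminant of a number field $F$. Here $p_i^{1/d_i}$ is the positive real $d_i$-th root. *)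

(* Defs.v *)
(* Number fields are [fieldExtType rat]s; the fixed algebraic closure of Q is
   [algC]. *)
From HB Require Import structures.
From mathcomp Require Import all_boot all_order all_algebra all_field.
From mathcomp Require Import all_classical all_reals all_analysis.

Set Implicit Arguments.
Unset Strict Implicit.
Unset Printing Implicit Defensive.

Import Order.TTheory GRing.Theory Num.Theory.
Import numFieldNormedType.Exports.

Local Open Scope classical_set_scope.
Local Open Scope ring_scope.

Definition padic_abs (R : realType) (p : nat) (q : rat) : R :=
  if q == 0 then 0
  else p%:R ^+ logn p `|denq q|%N / p%:R ^+ logn p `|numq q|%N.

Definition is_absolute_value (R : realType) (F : fieldExtType rat)
    (v : F -> R) : Prop :=
  [/\ forall x, 0 <= v x,
      forall x, v x = 0 <-> x = 0,
      forall x y, v (x * y) = v x * v y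
    & forall x y, v (x + y) <= v x + v y].

(* Each place is represented by its unique absolute value extending the usual
   archimedean or some usual p-adic absolute value of Q. *)
Definition places (R : realType) (F : fieldExtType rat) : set (F -> R) :=
  [set v | is_absolute_value v /\
     ((forall q : rat, v q%:A = ratr `|q|) \/
      (exists2 p : nat, prime p & forall q : rat, v q%:A = padic_abs R p q))].

(* The completion F_v is the set of v-Cauchy sequences of F
    modulo the v-null sequences, and Q_v is the completion of Q for the
    restriction of v. *)

Definition cauchy_for (R : realType) (F : fieldExtType rat) (v : F -> R)
    (u : nat -> F) : Prop :=
  forall e : R, 0 < e ->
    exists N : nat, forall m n : nat,
      (N <= m)%N -> (N <= n)%N -> v (u m - u n) < e.

Definition null_for (R : realType) (F : fieldExtType rat) (v : F -> R)
    (u : nat -> F) : Prop :=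
  v (u n) @[n --> \oo] --> (0 : R).

Definition cauchy_rat_for (R : realType) (F : fieldExtType rat) (v : F -> R)
    (c : nat -> rat) : Prop :=
  cauchy_for v (fun k => (c k)%:A).

(* The classes of b_0, ..., b_(n-1) form a basis of F_v over Q_v: they belong
   to F_v, they span it, and they are linearly independent. *)
Definition completion_basis (R : realType) (F : fieldExtType rat) (v : F -> R)
    (n : nat) (b : 'I_n -> nat -> F) : Prop :=
  [/\ forall i, cauchy_for v (b i),
      forall u, cauchy_for v u ->
        exists2 c : 'I_n -> nat -> rat,
          forall i, cauchy_rat_for v (c i)
        & null_for v (fun k => u k - \sum_(i < n) c i k *: b i k)
    & forall c : 'I_n -> nat -> rat,
        (forall i, cauchy_rat_for v (c i)) ->
        null_for v (fun k => \sum_(i < n) c i k *: b i k) ->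
        forall i, null_for v (fun k => (c i k)%:A)].

(* [F_v : Q_v] *)
Definition local_degree (R : realType) (F : fieldExtType rat) (v : F -> R) :
    nat :=
  xget 0%N [set n | exists b : 'I_n -> nat -> F, completion_basis v b].

(* Only finitely many factors differ from 1, so the finitely supported product
   is the product over all places. *)
Definition height_in (R : realType) (F : fieldExtType rat) (x : F) : R :=
  \big[*%R/1]_(v \in @places R F)
    (Num.max 1 (v x) `^ ((local_degree v)%:R / (\dim {:F})%:R)).

(* Q(alpha) as an abstract number field; Qadj_gen is alpha seen in it. *)
Definition Qadj (alpha : algC) : fieldExtType rat :=
  tag (num_field_exists [:: alpha]).

Definition Qadj_gen (alpha : algC) : Qadj alpha :=
  head 0 (s2val (tagged (tagged (num_field_exists [:: alpha])))).

Lemma Qadj_spec (alpha : algC) :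
  exists2 iota : {rmorphism Qadj alpha -> algC},
    iota (Qadj_gen alpha) = alpha & <<1; Qadj_gen alpha>>%VS = fullv.
Proof.
rewrite /Qadj_gen /Qadj.
case: (num_field_exists [:: alpha]) => F [iota [[|x [|y s]] //= [eq_x]]].
by rewrite adjoin_seq1 => gen_x; exists iota.
Qed.

(* The height does not depend on the number field containing alpha; it is
   computed in Q(alpha). *)
Definition weil_height (R : realType) (alpha : algC) : R :=
  height_in R (Qadj_gen alpha).

Definition northcott (R : realType) (A : set algC) : Prop :=
  forall X : R, 0 < X -> finite_set [set a | A a /\ weil_height R a <= X].

Definition algebraic_integer (F : fieldExtType rat) (x : F) : Prop :=
  integralOver (intr : int -> F) x.

Definition field_trace (F : fieldExtType rat) (x : F) : rat :=
  \tr (passmx.mxof (vbasis {:F}) (vbasis {:F}) (amull x)).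

Definition integral_basis (F : fieldExtType rat)
    (b : 'I_(\dim {:F}) -> F) : Prop :=
  (forall i, algebraic_integer (b i)) /\
  forall x : F, algebraic_integer x ->
    exists! c : {ffun 'I_(\dim {:F}) -> int}, x = \sum_i b i *~ c i.

(* The value is an integer and is the same for all integral bases. *)
Definition discriminant (F : fieldExtType rat) : int :=
  xget 0 [set D : int | exists2 b : 'I_(\dim {:F}) -> F, integral_basis b
    & D%:~R = \det (\matrix_(i, j) field_trace (b i * b j)) :> rat].

Definition eisenstein (p : nat) (D : {poly int}) : Prop :=
  [/\ D \is monic, (1 < size D)%N,
      forall j : nat, (j < (size D).-1)%N -> (p%:Z %| D`_j)%Z
    & ~~ ((p ^ 2)%:Z %| D`_0)%Z].

Definition is_subfield (A : set algC) : Prop :=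
  [/\ A 1, forall x y, A x -> A y -> A (x - y),
      forall x y, A x -> A y -> A (x * y)
    & forall x, A x -> A x^-1].

Definition generated_field (S : set algC) : set algC := smallest is_subfield S.

(* Main.v *)
(* Proof.  Let [N] be a large Galois number field, [w_P] a place of [N] over each
   place [P] of Q, and [G] the Galois group of [N] over Q.  The height satisfies
   [prod_P prod_(g in G) max(1, w_P (g y)) <= H(y)^#|G|], because the local degree
   at a place [v] is at least the number of embeddings inducing [v]; only this
   inequality is ever needed.

   Let [k] be generated by [K] and the [alpha_j] with [j < i], and write [p], [d],
   [a] for [p_i], [d_i], [alpha_i].  For large [i], every place [w] over [p] takes
   values in the powers of [p] on [k], since [k] is a compositum of fields of
   discriminant prime to [p].  As [w a = p^(-1/d)], the terms of a polynomial of
   degree [< d] over [k] evaluated at [a] have distinct absolute values.  Hence if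
   [y] in [k(a)] has a conjugate [y' <> y] over [k], then
   [w (y - y') <= p^(-1/d) max(1, w y) max(1, w y')] for all [w] over [p], and the
   product formula for the norm of [y - y'] gives [p^(1/d) <= 2 H(y)^2].  So
   elements of height at most [X] lie in a fixed finite stage of the tower, and
   Northcott's theorem applies. *)
Require Import Defs.
From HB Require Import structures.
From mathcomp Require Import all_boot all_order all_fingroup all_algebra all_field.
From mathcomp Require Import all_classical all_reals all_analysis.
From mathcomp Require Import complex.
From mathcomp Require Import ring lra zify.

Set Implicit Arguments.
Unset Strict Implicit.
Unset Printing Implicit Defensive.

Import Order.TTheory GRing.Theory Num.Theory.
Import numFieldNormedType.Exports.

Local Open Scope classical_set_scope.
Local Open Scope ring_scope.

(** * Absolute values and weak approximation *)

(** No single number field contains the whole tower, so [N] is chosen anew for each element and the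
    final estimate must be free of it: the exponent [#|G|] occurs on both sides and cancels. The
    norm of [y - y'] involves the values [w (g (y - y'))], and [w \o g] runs through several places
    over [p]; hence the closeness estimate is proved at every place over [p]. The 2 in it is the
    cost of one addition at the archimedean place.

    A discriminant prime to [p] says that the matrix of all embeddings of an integral basis is
    integral and unimodular at [p]. Solving a linear system with such a matrix does not increase
    absolute values, whatever the base field, so a compositum is reached by adjoining one generator
    at a time. For [K] a fixed rational basis serves once [p_i] is large, and [p_i >= p_i^(1/d_i)]
    tends to infinity.

    Weak approximation among the places over one [P] provides bases of completions, the finiteness
    of the set of places over [P], and simultaneous control of all conjugates of an element in the
    unramified step. *)

Lemma bernoulli (R : realType) (e : R) n : 0 <= e -> 1 + e *+ n <= (1 + e) ^+ n.
Proof.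
move=> e0; elim: n => [|n IH]; first by rewrite mulr0n addr0 expr0.
rewrite exprS; apply: (@le_trans _ _ ((1 + e) * (1 + e *+ n))); last first.
  by apply: ler_wpM2l IH; rewrite addr_ge0.
have : 0 <= e *+ n by rewrite mulrn_wge0.
by rewrite mulrS; move: (e *+ n) => a a0; nra.
Qed.

Lemma exp_gt_eventually (R : realType) (t B : R) :
  1 < t -> exists n, forall m, (n <= m)%N -> B < t ^+ m.
Proof.
move=> t1; have e0 : 0 < t - 1 by rewrite subr_gt0.
have [n nb] : exists n : nat, B / (t - 1) < n%:R.
  by exists (Num.bound `|B / (t - 1)|); apply: le_lt_trans (archi_boundP _);
    rewrite ?ler_norm.
exists n => m nm; apply: lt_le_trans (_ : B < (t - 1) *+ m) _.
  rewrite -(mulr_natr (t - 1)) mulrC -ltr_pdivrMr //.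
  by rewrite (lt_le_trans nb) // ler_nat.
have := bernoulli m (ltW e0); rewrite [1 + (t - 1)]addrC subrK.
by apply: le_trans; rewrite lerDr.
Qed.

Lemma exp_lt_eventually (R : realType) (a e : R) : 0 <= a < 1 -> 0 < e ->
  exists n, forall m, (n <= m)%N -> a ^+ m < e.
Proof.
case/andP=> a0 a1 e0; have [->|an0] := eqVneq a 0.
  by exists 1%N => m m1; rewrite expr0n -[m == 0]negbK -lt0n m1.
have ap : 0 < a by rewrite lt_def an0.
have [|n hn] := @exp_gt_eventually R a^-1 e^-1.
  by rewrite invf_gt1.
by exists n => m /hn; rewrite exprVn ltf_pV2 // posrE exprn_gt0.
Qed.

Section AbsoluteValue.
Variables (R : realType) (F : fieldExtType rat) (v : F -> R).
Hypothesis hv : is_absolute_value v.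

Lemma absv_ge0 x : 0 <= v x. Proof. by case: hv. Qed.

Lemma absvM x y : v (x * y) = v x * v y. Proof. by case: hv. Qed.

Lemma absvD x y : v (x + y) <= v x + v y. Proof. by case: hv. Qed.

Lemma absv_eq0 x : (v x == 0) = (x == 0).
Proof. by case: hv => _ h _ _; apply/eqP/eqP => /h. Qed.

Lemma absv0 : v 0 = 0. Proof. by apply/eqP; rewrite absv_eq0. Qed.

Lemma absv_gt0 x : (0 < v x) = (x != 0).
Proof. by rewrite lt_def absv_ge0 andbT absv_eq0. Qed.

Lemma absv1 : v 1 = 1.
Proof.
have n0 : v 1 != 0 by rewrite absv_eq0 oner_eq0.
by apply: (mulIf n0); rewrite -absvM !mul1r.
Qed.

Lemma absvX x n : v (x ^+ n) = v x ^+ n.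
Proof. by elim: n => [|n IH]; rewrite ?expr0 ?absv1 // !exprS absvM IH. Qed.

Lemma absvN x : v (- x) = v x.
Proof.
suff h : v (-1) = 1 by rewrite -mulN1r absvM h mul1r.
have : v (-1) ^+ 2 = 1 by rewrite -absvX sqrrN expr1n absv1.
by move/eqP; rewrite sqrp_eq1 ?absv_ge0 // => /eqP.
Qed.

Lemma absvV x : v x^-1 = (v x)^-1.
Proof.
have [->|x0] := eqVneq x 0; first by rewrite invr0 absv0 invr0.
have n0 : v x != 0 by rewrite absv_eq0.
by apply: (mulfI n0); rewrite -absvM !divff ?absv1.
Qed.

Lemma absvF x y : v (x / y) = v x / v y.
Proof. by rewrite absvM absvV. Qed.

Lemma absvB x y : v (x - y) <= v x + v y.
Proof. by rewrite (le_trans (absvD _ _)) // absvN. Qed.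

Lemma absvBC x y : v (x - y) = v (y - x).
Proof. by rewrite -absvN opprB. Qed.

Lemma absv_sub x y z : v (x - z) <= v (x - y) + v (y - z).
Proof. by apply: le_trans (absvD _ _); rewrite addrA subrK. Qed.

Lemma absv_lerB x y : v x - v y <= v (x - y).
Proof. by rewrite lerBlDr (le_trans _ (absvD _ _)) // subrK. Qed.

Lemma absv_sum (I : Type) (r : seq I) (P : pred I) (f : I -> F) :
  v (\sum_(i <- r | P i) f i) <= \sum_(i <- r | P i) v (f i).
Proof.
elim/big_ind2: _ => [|x a y b hx hy|//]; first by rewrite absv0.
by apply: le_trans (absvD _ _) _; exact: lerD.
Qed.

Lemma absv_prod (I : Type) (r : seq I) (P : pred I) (f : I -> F) :
  v (\prod_(i <- r | P i) f i) = \prod_(i <- r | P i) v (f i).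
Proof. exact: (big_morph v absvM absv1). Qed.

Lemma absv_comp (F' : fieldExtType rat) (f : {rmorphism F' -> F}) :
  is_absolute_value (v \o f).
Proof.
split=> [x|x|x y|x y] /=; first exact: absv_ge0.
- by split=> [/eqP|->]; rewrite ?rmorph0 ?absv0 // absv_eq0 fmorph_eq0 => /eqP.
- by rewrite rmorphM absvM.
- by rewrite rmorphD absvD.
Qed.

(* The usual power trick: [v (x + y)^n <= (n + 1) max(v x, v y)^n] when the
   binomial coefficients have absolute value at most 1. *)
Lemma absv_ultrametric : (forall n, v n%:R <= 1) ->
  forall x y, v (x + y) <= Num.max (v x) (v y).
Proof.
move=> h x y; set m := Num.max _ _.
have m0 : 0 <= m by rewrite le_max absv_ge0.
have hX n : v (x + y) ^+ n <= n.+1%:R * m ^+ n.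
  rewrite -absvX exprDn (le_trans (absv_sum _ _ _)) //.
  apply: (@le_trans _ _ (\sum_(i < n.+1) m ^+ n)); last first.
    by rewrite sumr_const card_ord mulr_natl.
  apply: ler_sum => i _; rewrite -mulr_natl absvM.
  apply: (@le_trans _ _ (1 * v (x ^+ (n - i) * y ^+ i))).
    by rewrite ler_wpM2r ?absv_ge0.
  rewrite mul1r absvM !absvX -[in m ^+ _](subnK (leq_ord i)) exprD.
  by apply: ler_pM; rewrite ?exprn_ge0 ?absv_ge0 // lerXn2r
    ?nnegrE ?absv_ge0 // le_max lexx ?orbT.
rewrite leNgt; apply/negP => hm.
have : 0 < v (x + y) by apply: le_lt_trans hm.
set b := v (x + y) in hX hm * => b0.
have [m00|mn0] := eqVneq m 0.
  by have := hX 1%N; rewrite m00 expr1 mulr0 leNgt b0.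
have mp : 0 < m by rewrite lt_def mn0.
have hX' n : (b / m) ^+ n <= n.+1%:R.
  by rewrite expr_div_n ler_pdivrMr ?exprn_gt0.
have t1 : 1 < b / m by rewrite ltr_pdivlMr // mul1r.
set t := b / m in hX' t1.
pose e := t - 1.
have e0 : 0 < e by rewrite subr_gt0.
have hB n : 1 + e *+ n <= t ^+ n.
  by have := bernoulli n (ltW e0); rewrite /e [1 + (t - 1)]addrC subrK.
(* The power [t ^+ (2n)] is at most [2n + 1] by [hX'] and at least [(1 + e n) ^+ 2] by Bernoulli;
   once [n > 4 / e ^+ 2] the quadratic bound exceeds the linear one. *)
pose n := (Num.bound (4 / (e ^+ 2)))%N.+1.
have nb : 4 / e ^+ 2 < n%:R.
  have : 4 / e ^+ 2 < (Num.bound (4 / (e ^+ 2)))%:R.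
    by apply: archi_boundP; rewrite divr_ge0 // exprn_ge0 // ltW.
  by move/lt_trans; apply; rewrite ltr_nat.
have : (1 + e *+ n) ^+ 2 <= (n.*2.+1)%:R.
  apply: le_trans (hX' n.*2); rewrite -mul2n mulnC exprM lerXn2r ?nnegrE //.
    by rewrite addr_ge0 // mulrn_wge0 // ltW.
  by rewrite exprn_ge0 // ltW // (lt_trans ltr01).
rewrite leNgt => /negP; apply.
rewrite -(mulr_natr e n) -addn1 natrD -mul2n natrM.
have e2 : 4 < n%:R * e ^+ 2 by rewrite -ltr_pdivrMr ?exprn_gt0.
have nn : 1 <= n%:R :> R by rewrite ler1n.
move: (n%:R) nn e2 => k nn e2.
have ke : 4 * k < k * e ^+ 2 * k by rewrite ltr_pM2r // (lt_le_trans ltr01).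
have ek : 0 <= e * k by rewrite mulr_ge0 // ltW // (lt_le_trans ltr01).
have -> : (1 + e * k) ^+ 2 = 1 + 2 * (e * k) + k * e ^+ 2 * k by ring.
lra.
Qed.

End AbsoluteValue.

(* [None] stands for the archimedean place of Q, [Some p] for the p-adic one. *)
Definition rat_place (P : option nat) : bool :=
  if P is Some p then prime p else true.

Definition rat_abs (R : realType) (P : option nat) (q : rat) : R :=
  if P is Some p then padic_abs R p q else ratr `|q|.

Definition place_over (R : realType) (F : fieldExtType rat) (P : option nat)
    (v : F -> R) : Prop :=
  is_absolute_value v /\ forall q : rat, v q%:A = rat_abs R P q.

(** * The p-adic absolute values of Q *)

Lemma padic_abs0 (R : realType) p : padic_abs R p 0 = 0.
Proof. by rewrite /padic_abs eqxx. Qed.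

(** Cross-multiplying a fraction with its reduced form, and additivity of [logn], show that any
    representation computes the value. Multiplicativity rests on this. *)
Lemma padic_absE (R : realType) p (a b : int) : prime p -> a != 0 -> b != 0 ->
  padic_abs R p (a%:~R / b%:~R) = p%:R ^+ logn p `|b| / p%:R ^+ logn p `|a|.
Proof.
move=> pp a0 b0; set q : rat := _ / _.
have q0 : q != 0 by rewrite mulf_neq0 ?invr_eq0 ?intr_eq0.
have p0 n : p%:R ^+ n != 0 :> R by rewrite expf_neq0 // pnatr_eq0 -lt0n prime_gt0.
rewrite /padic_abs (negPf q0); apply/eqP; rewrite eqr_div // -!exprD.
have [nq0 dq0] : (0 < `|numq q|)%N /\ (0 < `|denq q|)%N.
  by rewrite !absz_gt0 numq_eq0 q0 denq_eq0.
rewrite -!lognM // ?absz_gt0 // -!abszM.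
suff -> : denq q * a = b * numq q by [].
apply: (@intr_inj rat); rewrite !rmorphM /= [in RHS]numqE [in X in _ = _ * X]/q.
by rewrite [RHS]mulrA [_%:~R * (_ / _)]mulrCA divff ?intr_eq0 // mulr1 mulrC.
Qed.

Lemma padic_abs_gt0 (R : realType) p q : prime p -> q != 0 -> 0 < padic_abs R p q.
Proof.
move=> pp q0; rewrite /padic_abs (negPf q0).
by rewrite divr_gt0 // exprn_gt0 // ltr0n prime_gt0.
Qed.

Lemma padic_absM (R : realType) p q r : prime p ->
  padic_abs R p (q * r) = padic_abs R p q * padic_abs R p r.
Proof.
move=> pp; have [->|q0] := eqVneq q 0; first by rewrite !(mul0r, padic_abs0).
have [->|r0] := eqVneq r 0; first by rewrite !(mulr0, padic_abs0).
have nz x : x != 0 -> numq x != 0 by rewrite numq_eq0.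
rewrite -{1}(divq_num_den q) -{1}(divq_num_den r) mulf_div -!intrM.
rewrite padic_absE ?mulf_neq0 ?denq_eq0 ?nz // /padic_abs (negPf q0) (negPf r0).
by rewrite !abszM !lognM ?absz_gt0 ?denq_eq0 ?nz // !exprD mulf_div.
Qed.

Lemma padic_abs_int (R : realType) p (a : int) : prime p -> a != 0 ->
  padic_abs R p a%:~R = (p%:R ^+ logn p `|a|)^-1.
Proof.
move=> pp a0; have := @padic_absE R p a 1 pp a0 isT.
by rewrite divr1 => ->; rewrite logn1 expr0 mul1r.
Qed.

Lemma padic_abs_int_le1 (R : realType) p (a : int) : prime p ->
  padic_abs R p a%:~R <= 1.
Proof.
move=> pp; have [->|a0] := eqVneq a 0; first by rewrite padic_abs0.
rewrite padic_abs_int // invf_le1 ?exprn_ege1 ?ler1n ?prime_gt0 //.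
by rewrite exprn_gt0 // ltr0n prime_gt0.
Qed.

Lemma padic_abs_int_eq1 (R : realType) p (a : int) : prime p ->
  ~~ (p%:Z %| a)%Z -> padic_abs R p a%:~R = 1.
Proof.
move=> pp pa; have a0 : a != 0 by apply: contraNneq pa => ->; rewrite dvdz0.
rewrite padic_abs_int // logn_coprime ?expr0 ?invr1 //.
by rewrite prime_coprime // -[p]absz_nat -dvdzE.
Qed.

Lemma padic_abs_dvd (R : realType) p (a : int) : prime p ->
  (p%:Z %| a)%Z -> padic_abs R p a%:~R <= p%:R^-1.
Proof.
move=> pp pa; have [->|a0] := eqVneq a 0.
  by rewrite padic_abs0 invr_ge0 ler0n.
have p1 : 1 <= p%:R :> R by rewrite ler1n prime_gt0.
rewrite padic_abs_int // lef_pV2 ?posrE ?exprn_gt0 ?(lt_le_trans ltr01) //.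
rewrite -{1}[p%:R]expr1 ler_weXn2l //.
by rewrite -pfactor_dvdn ?absz_gt0 // expn1 -[p]absz_nat -dvdzE.
Qed.

Lemma padic_abs_prime (R : realType) p : prime p -> padic_abs R p p%:R = p%:R^-1.
Proof.
move=> pp; rewrite -[p%:R]/(p%:Z%:~R) padic_abs_int //; last first.
  by rewrite eqz_nat -lt0n prime_gt0.
by rewrite absz_nat logn_prime // eqxx expr1.
Qed.

Lemma rat_abs_small (R : realType) P : rat_place P ->
  exists t : rat, 0 < rat_abs R P t < 1.
Proof.
case: P => [p|] /= hP.
  exists p%:R; rewrite padic_abs_prime // invr_gt0 ltr0n prime_gt0 //.
  by rewrite invf_lt1 ?ltr1n ?prime_gt1 // ltr0n prime_gt0.
exists 2^-1; rewrite ger0_norm ?invr_ge0 // fmorphV rmorph_nat.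
by rewrite invr_gt0 ltr0n /= invf_lt1 ?ltr1n // ltr0n.
Qed.

(** * Weak approximation among the places over one place of Q *)

Section Approximation.
Variables (R : realType) (F : fieldExtType rat) (P : option nat).
Hypothesis hP : rat_place P.
Implicit Types v : F -> R.

(** Were [v2 <= v1] everywhere, inverses would give equality; so [v1 x < v2 x] for some [x]. A high
    power makes the ratio of the two values smaller than [c], and multiplication by a power of [t],
    which has the value [c] at both places, then moves 1 between them. *)
Lemma places_separated v1 v2 : place_over P v1 -> place_over P v2 -> v1 <> v2 ->
  exists x, v1 x < 1 /\ 1 < v2 x.
Proof.
move=> [a1 r1] [a2 r2] v12.
have [x] : exists x, v1 x < v2 x.
  apply: contra_notP v12 => nex; apply/funext => x; apply/eqP.
  rewrite eq_le !leNgt; apply/andP; split; last by apply/negP => h; apply: nex; exists x.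
  apply/negP => h; apply: nex; exists x^-1.
  have x0 : x != 0.
    by apply: contraTneq h => ->; rewrite (absv0 a1) (absv0 a2) ltxx.
  by rewrite (absvV a1) (absvV a2) ltf_pV2 // posrE ?(absv_gt0 a1) ?(absv_gt0 a2).
move=> xlt; have x0 : x != 0.
  by apply: contraTneq xlt => ->; rewrite (absv0 a1) (absv0 a2) ltxx.
have [t /andP[]] := rat_abs_small R hP; set c := rat_abs R P t => c0 c1.
have [n hn] : exists n, v1 x ^+ n < c * v2 x ^+ n.
  have [|n /(_ n (leqnn n)) hn] := @exp_lt_eventually _ (v1 x / v2 x) c _ c0.
    rewrite divr_ge0 ?(absv_ge0 a1) ?(absv_ge0 a2) //=.
    by rewrite ltr_pdivrMr ?(absv_gt0 a2) // mul1r.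
  exists n; move: hn.
  by rewrite expr_div_n ltr_pdivrMr // exprn_gt0 // (absv_gt0 a2).
set B := v2 x ^+ n in hn *.
have B0 : 0 < B by rewrite exprn_gt0 // (absv_gt0 a2).
have c01 : 0 <= c < 1 by rewrite ltW.
(* The factor [c ^+ k] brings [B] below 1, so that the least [m] with [c ^+ m < B * c ^+ k] is
   positive and has a predecessor. *)
have [k /(_ k (leqnn k)) hk] : exists k, forall m, (k <= m)%N -> c ^+ m < B^-1.
  by apply: exp_lt_eventually; rewrite // invr_gt0.
have ex : exists m, c ^+ m < B * c ^+ k.
  have [|m hm] := @exp_lt_eventually _ c (B * c ^+ k) c01.
    by rewrite mulr_gt0 // exprn_gt0.
  by exists m; exact: hm.
case: (ex_minnP ex) => -[|m] hm hmin.
  move: hm; rewrite expr0 ltNge; case/negP.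
  by rewrite -ler_pdivlMl // mulr1 ltW.
have {}hmin : B * c ^+ k <= c ^+ m.
  by rewrite leNgt; apply/negP => /hmin; rewrite ltnn.
have ct1 : v1 t%:A = c by rewrite r1.
have ct2 : v2 t%:A = c by rewrite r2.
exists (x ^+ n * t%:A ^+ k / t%:A ^+ m.+1).
rewrite (absvF a1) (absvF a2) !(absvM a1, absvX a1, absvM a2, absvX a2).
rewrite ct1 ct2 -/B; split; last by rewrite ltr_pdivlMr ?exprn_gt0 // mul1r.
rewrite ltr_pdivrMr ?exprn_gt0 // mul1r exprS.
apply: lt_le_trans (_ : c * B * c ^+ k <= _).
  by rewrite ltr_pM2r // exprn_gt0.
by rewrite -mulrA ler_pM2l.
Qed.

Lemma absv_frac_small v x (e : R) : is_absolute_value v -> v x < 1 -> 0 < e ->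
  exists n, forall m, (n <= m)%N -> v (x ^+ m / (1 + x ^+ m)) < e.
Proof.
move=> a x1 e0.
have [||n hn] := @exp_lt_eventually _ (v x) (e / (1 + e)).
- by rewrite (absv_ge0 a).
- by rewrite divr_gt0 // addr_gt0.
have e1 : 0 < 1 + e by rewrite addr_gt0.
exists n => m /hn; set y := x ^+ m; rewrite -(absvX a) -/y ltr_pdivlMr // => hy.
have hd : 1 - v y <= v (1 + y).
  by have := absv_lerB a 1 (- y); rewrite opprK (absvN a) (absv1 a).
have y0 := absv_ge0 a y.
have d0 : 0 < v (1 + y) by apply: lt_le_trans hd; nra.
by rewrite (absvF a) ltr_pdivrMr //; nra.
Qed.

Lemma absv_frac_near1 v x (e : R) : is_absolute_value v -> 1 < v x -> 0 < e ->
  exists n, forall m, (n <= m)%N -> v (x ^+ m / (1 + x ^+ m) - 1) < e.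
Proof.
move=> a x1 e0; have [n hn] := exp_gt_eventually (1 + e^-1) x1.
exists n => m /hn; set y := x ^+ m; rewrite -(absvX a) -/y => hy.
have hd : v y - 1 <= v (1 + y).
  by have := absv_lerB a y (-1); rewrite opprK (absvN a) (absv1 a) [y + 1]addrC.
have d0 : e^-1 < v (1 + y) by apply: lt_le_trans hd; rewrite ltrBrDl.
have dp : 0 < v (1 + y) by apply: lt_trans d0; rewrite invr_gt0.
have y0 : 1 + y != 0 by rewrite -(absv_gt0 a).
have -> : y / (1 + y) - 1 = - (1 + y)^-1.
  by apply: (mulIf y0); rewrite mulrBl mulNr mulVf // divfK // mul1r opprD addNKr
    addrC addNKr || field.
by rewrite (absvN a) (absvV a) -[e]invrK ltf_pV2 // posrE invr_gt0.
Qed.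

Lemma eventually_all (T : eqType) (s : seq T) (Q : T -> nat -> Prop) :
  (forall x, x \in s -> exists n, forall m, (n <= m)%N -> Q x m) ->
  exists n, forall m, (n <= m)%N -> forall x, x \in s -> Q x m.
Proof.
elim: s => [|x s IH] h; first by exists 0%N.
have [y ys|n1 h1] := IH; first by apply: h; rewrite inE ys orbT.
have [n2 h2] := h x (mem_head _ _); exists (maxn n1 n2) => m.
rewrite geq_max => /andP[m1 m2] y; rewrite inE => /orP[/eqP->|]; first exact: h2.
exact: h1.
Qed.

Lemma absv_add1_gt0 v x : is_absolute_value v -> 0 < 1 + v x.
Proof. by move=> a; rewrite ltr_pwDl ?(absv_ge0 a). Qed.

Lemma places_separated_seq v0 (s : seq (F -> R)) : place_over P v0 ->
  (forall v, v \in s -> place_over P v /\ v <> v0) ->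
  exists x, 1 < v0 x /\ forall v, v \in s -> v x < 1.
Proof.
move=> h0; have a0 := h0.1; elim: s => [|w s IH] hs.
  have [t /andP[t0 t1]] := rat_abs_small R hP; exists (t^-1)%:A; split=> //.
  rewrite h0.2; move: t0 t1; rewrite -!h0.2 -!in_algE fmorphV (absvV a0) => t0 t1.
  by rewrite invf_gt1.
have [hw wv0] := hs w (mem_head _ _); have aw := hw.1.
have {IH} [v vs|x [x0 xs]] := IH; first by apply: hs; rewrite inE vs orbT.
have av v : v \in s -> is_absolute_value v.
  by move=> vs; case: (hs v); rewrite ?inE ?vs ?orbT // => -[].
have [y [wy v0y]] := places_separated hw h0 wv0.
(* If [w x <= 1], a power of [x] times [y] works: the power is small on [s], and [w y < 1] takes
   care of [w]. If [w x > 1], the power is replaced by [f n], which tends to 0 on [s] but to 1 at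
   both [v0] and [w]. *)
have [wx|wx] := leP (w x) 1.
  have [v vs|n /(_ n (leqnn n)) hn] := @eventually_all _ s
      (fun v m => v (x ^+ m * y) < 1).
    have [||n hn] := @exp_lt_eventually _ (v x) (1 + v y)^-1.
    - by rewrite (absv_ge0 (av v vs)) xs.
    - by rewrite invr_gt0 (absv_add1_gt0 _ (av v vs)).
    exists n => m /hn; rewrite (absvM (av v vs)) (absvX (av v vs)).
    rewrite -[_^-1]mul1r ltr_pdivlMr ?(absv_add1_gt0 _ (av v vs)) //.
    have := absv_ge0 (av v vs) y; move: (v y) => b b0.
    have := exprn_ge0 m (absv_ge0 (av v vs) x); move: (v x ^+ m) => c c0.
    by nra.
  exists (x ^+ n * y); split.
    by rewrite (absvM a0) (absvX a0) (lt_le_trans v0y) // ler_peMl ?(absv_ge0 a0) ?exprn_ege1 ?ltW.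
  move=> v; rewrite inE => /orP[/eqP->|]; last exact: hn.
  rewrite (absvM aw) (absvX aw) (le_lt_trans _ wy) // ler_piMl ?(absv_ge0 aw) //.
  by rewrite exprn_ile1 ?(absv_ge0 aw).
pose f n := x ^+ n / (1 + x ^+ n).
have e1 : exists n, forall m, (n <= m)%N -> v0 (f m - 1) < 1 - (v0 y)^-1.
  by apply: absv_frac_near1 => //; rewrite subr_gt0 invf_lt1 // (lt_trans ltr01).
have e2 : exists n, forall m, (n <= m)%N -> w (f m - 1) < (1 + w y)^-1 * (1 - w y).
  apply: absv_frac_near1 => //.
  by rewrite mulr_gt0 ?subr_gt0 // invr_gt0 (absv_add1_gt0 _ aw).
have e3 : exists n, forall m, (n <= m)%N -> forall v, v \in s -> v (f m) < (1 + v y)^-1.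
  apply: eventually_all => v vs; apply: absv_frac_small (av v vs) (xs v vs) _.
  by rewrite invr_gt0 (absv_add1_gt0 _ (av v vs)).
case: e1 e2 e3 => n1 h1 [n2 h2] [n3 h3]; pose n := maxn n1 (maxn n2 n3).
exists (f n * y); split.
  have /h1 : (n1 <= n)%N by rewrite leq_maxl.
  have := absv_lerB a0 1 (f n); rewrite (absvBC a0 1) (absv1 a0) (absvM a0) => le1 lt1.
  have : (v0 y)^-1 < v0 (f n) by lra.
  by rewrite -[_^-1]mul1r ltr_pdivrMr // (lt_trans ltr01).
move=> v; rewrite inE => /orP[/eqP->|vs].
  have /h2 : (n2 <= n)%N by rewrite /n maxnCA leq_maxl.
  have := absv_lerB aw (f n) 1; rewrite (absv1 aw) (absvM aw).
  have wy0 := absv_ge0 aw y; have fy0 := absv_ge0 aw (f n).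
  move: (w (f n - 1)) => c le1; rewrite mulrC ltr_pdivlMr ?(absv_add1_gt0 _ aw) // => h.
  by nra.
have /h3/(_ v vs) : (n3 <= n)%N by rewrite /n !leq_max leqnn !orbT.
rewrite -[_^-1]mul1r ltr_pdivlMr ?(absv_add1_gt0 _ (av v vs)) //.
rewrite (absvM (av v vs)); apply: le_lt_trans; rewrite ler_wpM2l ?lerDr //.
exact: (absv_ge0 (av v vs)).
Qed.

Lemma weak_approximation v0 (s : seq (F -> R)) (u : F) (e : R) : place_over P v0 ->
  (forall v, v \in s -> place_over P v /\ v <> v0) -> 0 < e ->
  exists y, v0 (y - u) < e /\ forall v, v \in s -> v y < e.
Proof.
move=> h0 hs e0; have [x [x0 xs]] := places_separated_seq h0 hs; have a0 := h0.1.
have av v : v \in s -> is_absolute_value v by move=> /hs[[]].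
pose f n := x ^+ n / (1 + x ^+ n).
have e1 : exists n, forall m, (n <= m)%N -> v0 (f m - 1) < e / (1 + v0 u).
  apply: absv_frac_near1 => //.
  by rewrite divr_gt0 // (absv_add1_gt0 _ a0).
have e3 : exists n, forall m, (n <= m)%N -> forall v, v \in s -> v (f m) < e / (1 + v u).
  apply: eventually_all => v vs; apply: absv_frac_small (av v vs) (xs v vs) _.
  by rewrite divr_gt0 // (absv_add1_gt0 _ (av v vs)).
case: e1 e3 => n1 h1 [n2 h2]; pose n := maxn n1 n2; exists (f n * u); split.
  have /h1 : (n1 <= n)%N by rewrite leq_maxl.
  rewrite -[X in _ - X]mul1r -mulrBl (absvM a0).
  rewrite ltr_pdivlMr ?(absv_add1_gt0 _ a0) //.
  by apply: le_lt_trans; rewrite ler_wpM2l ?lerDr // (absv_ge0 a0).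
move=> v vs; have /h2/(_ v vs) : (n2 <= n)%N by rewrite leq_maxr.
rewrite ltr_pdivlMr ?(absv_add1_gt0 _ (av v vs)) // (absvM (av v vs)).
by apply: le_lt_trans; rewrite ler_wpM2l ?lerDr // (absv_ge0 (av v vs)).
Qed.

End Approximation.

(** * Embeddings of number fields *)

Lemma pchar0_fieldExt (F : fieldExtType rat) : [pchar F] =i pred0.
Proof. by move=> p; rewrite pchar_lalg pchar_num. Qed.

Lemma primitive_element_rat (F : fieldExtType rat) :
  exists t : F, <<1; t>>%VS = fullv.
Proof.
exists (separable_generator 1%AS {:F}%AS); apply/eqP; rewrite eqEsubv subvf.
apply: (@sub_adjoin_separable_generator _ _ {:F}%AS 1%AS).
by apply/separableP => x _; exact/pcharf0_separable/pchar0_fieldExt.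
Qed.

Lemma rat_minPolyP (F : fieldExtType rat) (x : F) : exists q : {poly rat},
  [/\ q \is monic, minPoly 1 x = map_poly (in_alg F) q
    & forall p, root (map_poly (in_alg F) p) x = (q %| p)].
Proof.
have /polyOver1P[q eq] : minPoly 1 x \is a polyOver 1%VS := minPolyOver _ _.
exists q; split=> // [|p].
  by rewrite -(map_monic (in_alg F)) -eq monic_minPoly.
rewrite -(dvdp_map (in_alg F)) -eq; apply/idP/idP => [|/dvdpP[r ->]].
  exact/minPoly_dvdp/(alg_polyOver 1%AS).
by rewrite rootM root_minPoly orbT.
Qed.

Lemma map_in_alg (F N : fieldExtType rat) (f : {rmorphism F -> N}) p :
  map_poly f (map_poly (in_alg F) p) = map_poly (in_alg N) p.
Proof.
rewrite -map_poly_comp; apply: eq_map_poly => a /=.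
by rewrite fmorph_numZ rmorph1.
Qed.

Lemma minPoly_rmorph (F N : fieldExtType rat) (f : {rmorphism F -> N}) x q :
  minPoly 1 x = map_poly (in_alg F) q -> minPoly 1 (f x) = map_poly (in_alg N) q.
Proof.
have [q1 [m1 e1 h1]] := rat_minPolyP x.
have [q2 [m2 e2 h2]] := rat_minPolyP (f x).
rewrite e1 e2 => /map_poly_inj <-; congr map_poly.
apply/eqP; rewrite -eqp_monic // /eqp -h1 -h2.
apply/andP; split; first by rewrite -(map_in_alg f) fmorph_root h1; exact: dvdpp.
by rewrite -(fmorph_root f) map_in_alg h2; exact: dvdpp.
Qed.

(** This is the universal property of [Q[X]/(q)]: each element gets a chosen polynomial in [t], and
    the value of that polynomial at [z] is independent of the choice because [q] divides any
    difference. The target is an arbitrary field since both [N] and the complex numbers over [R]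
    occur. *)
Lemma rmorphism_of_root (F : fieldExtType rat) (t : F) (q : {poly rat})
    (L : fieldType) (g : {rmorphism rat -> L}) (z : L) :
    <<1; t>>%VS = fullv -> minPoly 1 t = map_poly (in_alg F) q ->
    root (map_poly g q) z ->
  exists f : {rmorphism F -> L}, f t = z.
Proof.
move=> gen_t qt qz; have [q1 [_ e1 hq]] := rat_minPolyP t.
move: e1; rewrite qt => /map_poly_inj e1; rewrite -{}e1 in hq.
pose ev p := (map_poly (in_alg F) p).[t].
have ex x : exists p, ev p = x.
  have : x \in <<1; t>>%VS by rewrite gen_t memvf.
  by case/Fadjoin1_polyP => p ->; exists p.
pose rp x := sval (cid (ex x)).
have rpE x : ev (rp x) = x by rewrite /rp; case: cid.
pose evL p := (map_poly g p).[z].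
have evL_eq p1 p2 : ev p1 = ev p2 -> evL p1 = evL p2.
  move=> e; have : root (map_poly (in_alg F) (p1 - p2)) t.
    by rewrite /root rmorphB hornerD hornerN; apply/eqP/subr0_eq; rewrite subr0 -/(ev p1) e subrr.
  rewrite hq => /dvdpP[r e2]; apply/eqP.
  by rewrite -subr_eq0 -hornerN -hornerD -rmorphB e2 rmorphM hornerM (rootP qz) mulr0.
pose f x := evL (rp x).
have fz : zmod_morphism f.
  move=> x y; rewrite -hornerN -hornerD -rmorphB; apply: evL_eq.
  by rewrite rpE /ev rmorphB hornerD hornerN -/(ev _) -/(ev _) !rpE.
have fm : monoid_morphism f.
  split=> [|x y].
    rewrite -[RHS](hornerC 1 z) polyC1 -(rmorph1 (map_poly g)); apply: evL_eq.
    by rewrite rpE /ev rmorph1 hornerC.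
  rewrite -hornerM -rmorphM; apply: evL_eq.
  by rewrite rpE /ev rmorphM hornerM -/(ev _) -/(ev _) !rpE.
pose fzM := GRing.isZmodMorphism.Build _ _ f fz.
pose fmM := GRing.isMonoidMorphism.Build _ _ f fm.
pose fRM : {rmorphism F -> L} := HB.pack f fzM fmM.
exists fRM; rewrite /= -[RHS]hornerX -(map_polyX g); apply: evL_eq.
by rewrite rpE /ev map_polyX hornerX.
Qed.

Lemma rmorphism_eq_gen (F : fieldExtType rat) (t : F)
    (L : fieldType) (f g : {rmorphism F -> L}) :
  <<1; t>>%VS = fullv -> f t = g t -> f =1 g.
Proof.
move=> gen_t ftg x.
have : x \in <<1; t>>%VS by rewrite gen_t memvf.
case/Fadjoin1_polyP => p ->; rewrite -!horner_map /= ftg; congr _.[_].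
rewrite -!map_poly_comp; apply: eq_map_poly => a /=.
by rewrite alg_num_field !fmorph_rat.
Qed.

Definition embedding_mx (F N : fieldExtType rat) (m n : nat)
    (s : 'I_m -> {rmorphism F -> N}) (b : 'I_n -> F) : 'M[N]_(m, n) :=
  \matrix_(i, j) s i (b j).

(** The existence of [f] puts one root of the minimal polynomial of [t] into [N]; normality then
    gives all of them, and separability makes them distinct, one for each embedding. *)
Lemma embeddings_exist (F : fieldExtType rat) (N : splittingFieldType rat)
    (f : {rmorphism F -> N}) :
  exists2 s : 'I_(\dim {:F}) -> {rmorphism F -> N},
    forall g : {rmorphism F -> N}, exists i, g =1 s i
  & embedding_mx s (fun i => (vbasis {:F})`_i) \in unitmx.
Proof.
have [t gen_t] := primitive_element_rat F.
have [q [mq eq hq]] := rat_minPolyP t.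
have dn : size q = (\dim {:F}).+1.
  have := size_minPoly 1%AS t; rewrite eq size_map_poly => ->; congr _.+1.
  by rewrite -gen_t dim_Fadjoin dimv1 muln1.
have eN (g : {rmorphism F -> N}) : minPoly 1 (g t) = map_poly (in_alg N) q.
  exact: minPoly_rmorph.
have [r /eqP er] := splitting_field_normal 1%AS (f t).
have sr : size r == \dim {:F}.
  have := congr1 (size : {poly N} -> nat) er.
  by rewrite eN size_map_poly dn size_prod_XsubC => -[->].
have ur : uniq r.
  rewrite -separable_prod_XsubC -er.
  by exact/pcharf0_separable/pchar0_fieldExt.
have tr i : exists g : {rmorphism F -> N}, g t = tnth (Tuple sr) i.
  apply: (rmorphism_of_root (g := in_alg N) gen_t eq).
  by rewrite -(eN f) er root_prod_XsubC (tnth_nth 0) mem_nth // (eqP sr).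
have [s hs] := choice tr.
exists s.
  move=> g; have : g t \in Tuple sr.
    by rewrite memtE /= -root_prod_XsubC -er eN -(eN g) root_minPoly.
  case/tnthP => i ei; exists i; apply: (rmorphism_eq_gen gen_t).
  by rewrite hs.
set P := embedding_mx _ _.
(* The columns of [A] are the coordinates of the powers of [t], so [A] turns the embedding matrix
   into a Vandermonde matrix with distinct nodes. *)
pose A : 'M[N]_(\dim {:F}) := \matrix_(j, k) (coord (vbasis {:F}) j (t ^+ k))%:A.
have PA : (P *m A)^T = Vandermonde _ (\row_i tnth (Tuple sr) i).
  apply/matrixP => k i; rewrite !mxE -hs -rmorphXn.
  rewrite [in RHS](coord_vbasis (memvf (t ^+ k))) rmorph_sum; apply: eq_bigr => j _.
  by rewrite !mxE /= fmorph_numZ mulr_algr.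
have : (P *m A)^T \in unitmx.
  rewrite PA unitmxE det_Vandermonde unitfE.
  apply/prodf_neq0 => i _; apply/prodf_neq0 => j ij.
  rewrite !mxE subr_eq0 !(tnth_nth 0) nth_uniq ?(eqP sr) //.
  by rewrite neq_ltn ij orbT.
by rewrite unitmx_tr unitmx_mul => /andP[].
Qed.

(** The embedding matrix diagonalizes multiplication by [x], with the conjugates of [x] as
    eigenvalues. *)
Lemma field_trace_embeddings (F N : fieldExtType rat)
    (s : 'I_(\dim {:F}) -> {rmorphism F -> N}) (x : F) :
  embedding_mx s (fun i => (vbasis {:F})`_i) \in unitmx ->
  (field_trace x)%:A = \sum_i s i x.
Proof.
set e := vbasis {:F}; set P := embedding_mx _ _ => uP.
have eb : basis_of {:F} e := vbasisP _.
pose A := passmx.mxof e e (amull x).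
pose B := map_mx (in_alg N) A.
have PB : P *m B^T = diag_mx (\row_i s i x) *m P.
  apply/matrixP => i j; rewrite mul_diag_mx !mxE -rmorphM.
  have -> : x * e`_j = passmx.vecof e (row j A).
    rewrite rowE -[A]/(passmx.mxof _ _ _) passmx.mul_mxof // passmx.rVofK //.
    by rewrite -(passmx.rVofE eb) passmx.rVofK // lfunE.
  rewrite /passmx.vecof rmorph_sum; apply: eq_bigr => k _.
  by rewrite !mxE /= fmorph_numZ mulr_algr.
have -> : (field_trace x)%:A = \tr B.
  by rewrite /field_trace -/e -/A -in_algE -trace_map_mx.
rewrite -mxtrace_tr -[B^T](mulKmx uP) PB mxtrace_mulC mulmxK // mxtrace_diag.
by apply: eq_bigr => i _; rewrite mxE.
Qed.

Lemma det_embedding_mx (F N : fieldExtType rat)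
    (s : 'I_(\dim {:F}) -> {rmorphism F -> N}) (b : 'I_(\dim {:F}) -> F) :
  embedding_mx s (fun i => (vbasis {:F})`_i) \in unitmx ->
  (\det (\matrix_(i, j) field_trace (b i * b j)))%:A
    = \det (embedding_mx s b) ^+ 2.
Proof.
move=> us; rewrite expr2 -[X in X * _]det_tr -det_mulmx -in_algE -det_map_mx; congr (\det _).
apply/matrixP => i j; rewrite !mxE /= (field_trace_embeddings _ us).
by apply: eq_bigr => k _; rewrite !mxE rmorphM.
Qed.

(** * Local degrees *)

Section Completion.
Variables (R : realType) (F : fieldExtType rat) (v : F -> R).
Hypothesis hv : is_absolute_value v.
Implicit Types u : nat -> F.

Lemma null_forP u : null_for v u <->
  forall e : R, 0 < e -> exists n0, forall n, (n0 <= n)%N -> v (u n) < e.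
Proof.
split=> [/cvgrPdist_lt h e /h [n0 _ hn]|h].
  exists n0 => n nn; have /= := hn n nn.
  by rewrite sub0r normrN ger0_norm ?(absv_ge0 hv).
apply/cvgrPdist_lt => e /h [n0 hn]; exists n0 => // n /= nn.
by rewrite sub0r normrN ger0_norm ?(absv_ge0 hv) // hn.
Qed.

Lemma null_forD u1 u2 : null_for v u1 -> null_for v u2 -> null_for v (u1 \+ u2).
Proof.
move=> /null_forP h1 /null_forP h2; apply/null_forP => e e0.
have e2 : 0 < e / 2 by rewrite divr_gt0.
have [n1 hn1] := h1 _ e2; have [n2 hn2] := h2 _ e2.
exists (maxn n1 n2) => n; rewrite geq_max => /andP[/hn1 l1 /hn2 l2].
by rewrite (le_lt_trans (absvD hv _ _)) // [e]splitr ltrD.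
Qed.

Lemma cauchy_for_bounded u : cauchy_for v u ->
  exists2 B, 0 < B & forall n, v (u n) <= B.
Proof.
move=> /(_ 1 ltr01)[n0 hn].
exists (1 + \sum_(i < n0.+1) v (u i)) => [|n].
  by rewrite ltr_pwDl // sumr_ge0 // => i _; exact: absv_ge0.
have [nn|nn] := leqP n n0.
  rewrite (bigD1 (inord n)) //= inordK ?ltnS // addrCA lerDl addr_ge0 //.
  by rewrite sumr_ge0 // => i _; exact: absv_ge0.
have := absv_sub hv (u n) (u n0) 0; rewrite !subr0 => /le_trans; apply.
apply: lerD; first by rewrite ltW // hn // ltnW.
rewrite (bigD1 ord_max) //= lerDl.
by rewrite sumr_ge0 // => i _; exact: absv_ge0.
Qed.

Lemma null_forM u1 u2 : cauchy_for v u1 -> null_for v u2 -> null_for v (u1 \* u2).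
Proof.
move=> /cauchy_for_bounded[B B0 hB] /null_forP h2; apply/null_forP => e e0.
have [n0 hn] := h2 (e / B) (divr_gt0 e0 B0).
exists n0 => n /hn; rewrite ltr_pdivlMr // => h.
rewrite /= (absvM hv) (le_lt_trans _ h) // mulrC.
by rewrite ler_wpM2l // (absv_ge0 hv).
Qed.

Lemma cauchy_forD u1 u2 : cauchy_for v u1 -> cauchy_for v u2 ->
  cauchy_for v (u1 \+ u2).
Proof.
move=> h1 h2 e e0; have e2 : 0 < e / 2 by rewrite divr_gt0.
have [n1 hn1] := h1 _ e2; have [n2 hn2] := h2 _ e2.
exists (maxn n1 n2) => m n; rewrite !geq_max => /andP[m1 m2] /andP[l1 l2] /=.
rewrite opprD addrACA (le_lt_trans (absvD hv _ _)) // [e]splitr.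
by rewrite ltrD ?hn1 ?hn2.
Qed.

Lemma cauchy_forM u1 u2 : cauchy_for v u1 -> cauchy_for v u2 ->
  cauchy_for v (u1 \* u2).
Proof.
move=> h1 h2 e e0.
have [B1 B10 hB1] := cauchy_for_bounded h1.
have [B2 B20 hB2] := cauchy_for_bounded h2.
have [|n1 hn1] := h1 (e / 2 / B2); first by rewrite !divr_gt0.
have [|n2 hn2] := h2 (e / 2 / B1); first by rewrite !divr_gt0.
exists (maxn n1 n2) => m n; rewrite !geq_max => /andP[m1 m2] /andP[l1 l2] /=.
have -> : u1 m * u2 m - u1 n * u2 n = (u1 m - u1 n) * u2 m + u1 n * (u2 m - u2 n).
  by ring.
rewrite (le_lt_trans (absvD hv _ _)) // !(absvM hv) [e]splitr ltrD //.
  have := hn1 m n m1 l1; rewrite ltr_pdivlMr //; apply: le_lt_trans.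
  by rewrite ler_wpM2l // (absv_ge0 hv).
have := hn2 m n m2 l2; rewrite ltr_pdivlMr // mulrC; apply: le_lt_trans.
by rewrite ler_wpM2r // (absv_ge0 hv).
Qed.

Lemma cauchy_forN u : cauchy_for v u -> cauchy_for v (fun n => - u n).
Proof.
move=> h e /h [n0 hn]; exists n0 => m n mn nn.
by rewrite -opprD (absvN hv) hn.
Qed.

Lemma not_null_bounded_below u : cauchy_for v u -> ~ null_for v u ->
  exists2 d, 0 < d & exists n0, forall n, (n0 <= n)%N -> d <= v (u n).
Proof.
move=> cu /null_forP /existsNP[e /not_implyP[e0 nh]].
have e2 : 0 < e / 2 by rewrite divr_gt0.
exists (e / 2) => //; have [n0 hn] := cu _ e2; exists n0 => n nn.
move/forallNP: nh => /(_ n0)/existsNP[m /not_implyP[mn /negP]].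
rewrite -leNgt => em; have := hn m n mn nn.
have := absv_lerB hv (u m) (u n); rewrite {1}[e]splitr in em; lra.
Qed.

Lemma cauchy_forV u (d : R) : cauchy_for v u -> 0 < d ->
    (exists n0, forall n, (n0 <= n)%N -> d <= v (u n)) ->
  cauchy_for v (fun n => (u n)^-1).
Proof.
move=> cu d0 [n0 hd] e e0.
have [|n1 hn] := cu (e * d ^+ 2); first by rewrite mulr_gt0 // exprn_gt0.
exists (maxn n0 n1) => m n; rewrite !geq_max => /andP[m0 m1] /andP[l0 l1].
have um := hd m m0; have un := hd n l0.
have nz k : d <= v (u k) -> u k != 0.
  by move=> h; rewrite -(absv_gt0 hv) (lt_le_trans d0).
have -> : (u m)^-1 - (u n)^-1 = (u n - u m) / (u m * u n).
  by field; rewrite !nz.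
rewrite (absvF hv) ltr_pdivrMr; last by rewrite (absv_gt0 hv) mulf_neq0 ?nz.
rewrite (absvBC hv); apply: lt_le_trans (hn m n m1 l1) _.
by rewrite ler_pM2l // (absvM hv) expr2 ler_pM // ltW.
Qed.

Definition completion_spanned (n : nat) (b : 'I_n -> nat -> F) : Prop :=
  (forall i, cauchy_for v (b i)) /\
  forall u, cauchy_for v u ->
    exists2 c : 'I_n -> nat -> rat,
      forall i, cauchy_rat_for v (c i)
    & null_for v (fun k => u k - \sum_(i < n) c i k *: b i k).

(* A spanning family of least cardinality is a basis. *)
Lemma completion_basis_exists n (b : 'I_n -> nat -> F) : completion_spanned b ->
  exists m (b' : 'I_m -> nat -> F), completion_basis v b'.
Proof.
move=> hb; have ex : exists m, `[< exists b : 'I_m -> nat -> F, completion_spanned b >].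
  by exists n; apply/asboolP; exists b.
case: (ex_minnP ex) => m /asboolP[b' [cb sb]] mmin; exists m, b'; split=> // c cc nc i.
apply: contrapT => nci; case: m b' cb sb mmin c cc nc i nci => [|m] b' cb sb mmin c cc nc i nci.
  by case: i nci.
suff : (m.+1 <= m)%N by rewrite ltnn.
apply: mmin; apply/asboolP; exists (fun j => b' (lift i j)); split=> // u cu.
have [d d0 [n0 hd]] := not_null_bounded_below (cc i) nci.
have cV : cauchy_for v (fun k => ((c i k)%:A : F)^-1).
  by apply: cauchy_forV (cc i) d0 _; exists n0.
have [x cx nx] := sb u cu.
(* The relation is solved for its [i]-th member: [x i / c i] times the relation is subtracted from
   the expansion of [u]. Division is legitimate since [c i] is eventually bounded away from 0. *)
exists (fun j k => x (lift i j) k - x i k * c (lift i j) k / c i k) => [j|].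
  have -> : cauchy_rat_for v (fun k => x (lift i j) k - x i k * c (lift i j) k / c i k) =
     cauchy_for v ((fun k => (x (lift i j) k)%:A) \+ fun k => - (((fun k => (x i k)%:A)
        \* (fun k => (c (lift i j) k)%:A) \* (fun k => ((c i k)%:A)^-1)) k)).
    congr cauchy_for; apply/funext => k.
    by rewrite /= -!in_algE rmorphB !rmorphM fmorphV.
  apply: cauchy_forD (cx _) (cauchy_forN _).
  exact: cauchy_forM (cauchy_forM (cx i) (cc (lift i j))) cV.
have h := null_forD nx (null_forM (cauchy_forM (cx i) cV) nc).
apply/null_forP => e e0; have [n1 hn1] := (null_forP _).1 h e e0.
exists (maxn n0 n1) => k; rewrite geq_max => /andP[/hd dk /hn1]; congr (v _ < e).
have ci0 : c i k != 0.
  by apply: contraTneq dk => ->; rewrite scale0r (absv0 hv) leNgt d0.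
rewrite /=; have -> : (x i k)%:A / (c i k)%:A = (x i k / c i k)%:A :> F.
  by rewrite -!in_algE rmorphM fmorphV.
rewrite mulr_algl.
have e1 (y : 'I_m.+1 -> nat -> rat) : \sum_(i0 < m.+1) y i0 k *: b' i0 k
    = y i k *: b' i k + \sum_(j < m) y (lift i j) k *: b' (lift i j) k.
  by rewrite (bigD1_ord i).
have -> : \sum_(j < m) (x (lift i j) k - x i k * c (lift i j) k / c i k) *: b' (lift i j) k
   = \sum_(j < m) x (lift i j) k *: b' (lift i j) k
     - (x i k / c i k) *: \sum_(j < m) c (lift i j) k *: b' (lift i j) k.
  rewrite scaler_sumr -sumrB; apply: eq_bigr => j _.
  by rewrite scalerA -scalerBl; congr (_ *: _); field.
rewrite !e1 scalerDr scalerA divfK //.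
set A := \sum_(j < m) _; set B := (_ / _) *: _; set C := x i k *: _.
by ring.
Qed.

End Completion.

Lemma place_over_comp (R : realType) (F N : fieldExtType rat) P (w : N -> R)
    (f : {rmorphism F -> N}) :
  place_over P w -> place_over P (w \o f).
Proof.
case=> hw hq; split=> [|q /=]; first exact: absv_comp.
by rewrite fmorph_numZ rmorph1 hq.
Qed.

Section LocalDegree.
Variables (R : realType) (F N : fieldExtType rat) (P : option nat) (w : N -> R).
Variable s : 'I_(\dim {:F}) -> {rmorphism F -> N}.
Hypothesis hP : rat_place P.
Hypothesis hw : place_over P w.
Let e (i : 'I_(\dim {:F})) : F := (vbasis {:F})`_i.
Let M := embedding_mx s e.
Hypothesis uM : M \in unitmx.

(** Rational coordinates are fixed [N]-linear combinations of the conjugates, so convergence of all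
    conjugates at [w] carries over to the coordinates. *)
Lemma embedding_coord (y : F) i :
  (coord (vbasis {:F}) i y)%:A = \sum_l invmx M i l * s l y.
Proof.
pose c : 'cV[N]_(\dim {:F}) := \col_i (coord (vbasis {:F}) i y)%:A.
have h : M *m c = \col_l s l y.
  apply/colP => l; rewrite !mxE [in RHS](coord_vbasis (memvf y)) rmorph_sum.
  by apply: eq_bigr => j _; rewrite !mxE /= fmorph_numZ mulr_algr.
have := congr1 (fun x : 'cV[N]_(\dim {:F}) => x i 0) (mulKmx uM c).
by rewrite h !mxE => <-; apply: eq_bigr => l _; rewrite mxE.
Qed.

(* Weak approximation replaces a [v]-Cauchy sequence of [F] by one that tends to 0
   at the other places; then all its conjugates are Cauchy for [w], hence so are
   its rational coordinates. *)
Lemma completion_spanned_vbasis (v : F -> R) i0 : v = w \o s i0 ->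
  completion_spanned v (fun i _ => e i).
Proof.
move=> vE; have pv : place_over P v by rewrite vE; exact: place_over_comp.
have hv := pv.1; split=> [i e1 e10|u cu].
  by exists 0%N => m n _ _; rewrite subrr (absv0 hv).
pose others := [seq x <- [seq (w \o s i : F -> R) | i <- enum 'I_(\dim {:F})] | x != v].
have ho x : x \in others -> place_over P x /\ x <> v.
  rewrite mem_filter => /andP[/eqP xv /mapP[i _ xE]]; split=> //.
  by rewrite xE; exact: place_over_comp.
have ap k : exists y, v (y - u k) < k.+1%:R^-1 /\
    forall i, (w \o s i : F -> R) != v -> w (s i y) < k.+1%:R^-1.
  have [|y [y1 y2]] := weak_approximation hP (u k) pv ho (e := k.+1%:R^-1).
    by rewrite invr_gt0 ltr0n.
  exists y; split=> // i ne; apply: y2 (w \o s i) _.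
  by rewrite mem_filter ne; apply/mapP; exists i; rewrite ?mem_enum.
have [y hy] := choice ap.
have inv_small e1 : 0 < e1 -> exists n, forall k, (n <= k)%N -> k.+1%:R^-1 < e1 :> R.
  move=> e10; exists (Num.bound e1^-1) => k nk.
  rewrite -[e1]invrK ltf_pV2 ?posrE ?invr_gt0 ?ltr0n //.
  apply: lt_le_trans (archi_boundP _) _; first by rewrite invr_ge0 ltW.
  by rewrite ler_nat leqW.
have cy l : cauchy_for w (fun k => s l (y k)).
  move=> e1 e10; have [n1 h1] := inv_small _ (divr_gt0 e10 (ltr0n R 4)).
  have [n2 h2] := cu _ (divr_gt0 e10 (ltr0n R 4)).
  exists (maxn n1 n2) => m n; rewrite !geq_max => /andP[m1 m2] /andP[l1 l2].
  have := h1 _ m1; have := h1 _ l1; have := h2 _ _ m2 l2 => h3 h4 h5.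
  rewrite -rmorphB; have [ev|ne] := eqVneq (w \o s l : F -> R) v.
    have -> : w (s l (y m - y n)) = v (y m - y n) by rewrite -ev.
    have := absv_sub hv (y m) (u m) (y n); have := absv_sub hv (u m) (u n) (y n).
    have := (hy m).1; have := (hy n).1; rewrite (absvBC hv (y n) (u n)).
    by move: (m.+1%:R^-1) (n.+1%:R^-1) h4 h5 => M1 N1 h4 h5; lra.
  rewrite rmorphB; have := absvB hw.1 (s l (y m)) (s l (y n)).
  have := (hy m).2 l ne; have := (hy n).2 l ne.
  by move: (m.+1%:R^-1) (n.+1%:R^-1) h4 h5 => M1 N1 h4 h5; lra.
exists (fun i k => coord (vbasis {:F}) i (y k)) => [i|].
  move=> e1 e10; pose B := 1 + \sum_l w (invmx M i l).
  have B0 : 0 < B by rewrite ltr_pwDl // sumr_ge0 // => l _; exact: absv_ge0 hw.1 _.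
  have [//|n hn] := @eventually_all _ (enum 'I_(\dim {:F})) (fun l n =>
      forall m, (n <= m)%N -> w (s l (y m - y n)) < e1 / B).
    move=> l _; have [n hn] := cy l _ (divr_gt0 e10 B0).
    by exists n => m nm k mk; rewrite rmorphB hn // (leq_trans nm).
  have key m k : (n <= k)%N -> (k <= m)%N ->
      v ((coord (vbasis {:F}) i (y m))%:A - (coord (vbasis {:F}) i (y k))%:A) < e1.
    move=> nk km; rewrite -scalerBl -linearB pv.2 -hw.2 embedding_coord.
    apply: le_lt_trans (absv_sum hw.1 _ _ _) _.
    apply: (@le_lt_trans _ _ (\sum_l w (invmx M i l) * (e1 / B))).
      apply: ler_sum => l _; rewrite (absvM hw.1) ler_wpM2l ?(absv_ge0 hw.1) //.
      by rewrite ltW // hn // mem_enum.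
    rewrite -mulr_suml mulrA ltr_pdivrMr // mulrC ltr_pM2l //.
    by rewrite /B ltrDr.
  exists n => m k nm nk; have [km|/ltnW mk] := leqP k m; first exact: key.
  by rewrite (absvBC hv) key.
apply/(null_forP hv) => e1 /inv_small[n hn]; exists n => k /hn.
apply: lt_trans; rewrite (absvBC hv).
rewrite -(_ : y k = \sum_(i < _) coord (vbasis {:F}) i (y k) *: e i).
  exact: (hy k).1.
exact: coord_vbasis (memvf _).
Qed.

(* A spanning family of size [n] factors, up to a small error, an invertible
   matrix of size the number of embeddings inducing [v] through dimension [n]. *)
Lemma completion_basis_card (v : F -> R) n (b : 'I_n -> nat -> F) :
  completion_spanned v b ->
  (#|[pred i | (w \o s i : F -> R) == v]| <= n)%N.
Proof.
set T := [pred i | _]; case=> _ sb.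
have [i0 i0T|T0] := pickP T; last by rewrite eq_card0.
have vE : v = w \o s i0 by move/eqP: i0T.
have pv : place_over P v by rewrite vE; exact: place_over_comp.
have hv := pv.1; rewrite leqNgt; apply/negP => nT.
have ce j : cauchy_for v (fun _ => e j).
  by move=> e1 e10; exists 0%N => m k _ _; rewrite subrr (absv0 hv).
have /choice[c hc] j : exists c : 'I_n -> nat -> rat,
    null_for v (fun k => e j - \sum_(i < n) c i k *: b i k).
  by have [c _ nc] := sb _ (ce j); exists c.
pose r (i : 'I_#|T|) := enum_val i.
have rE i x : w (s (r i) x) = v x.
  by have /eqP <- : T (r i) := enum_valP i.
pose B := 1 + \sum_j \sum_l w (invmx M j l).
have B0 : 0 < B.
  by rewrite ltr_pwDl // sumr_ge0 // => j _; rewrite sumr_ge0 // => l _; exact: absv_ge0 hw.1 _.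
have T0 : 0 < (#|T|%:R : R) by rewrite ltr0n (leq_trans _ nT).
(* All basis vectors are approximated at one common index [k], with the precision that keeps the
   entries of [E] below [1 / #|T|]. *)
have [j _|k /(_ k (leqnn k)) hk] := @eventually_all _ (enum 'I_(\dim {:F})) (fun j k =>
    v (e j - \sum_(i < n) c j i k *: b i k) < (#|T|%:R * B)^-1).
  by apply: (null_forP hv _).1 => //; rewrite invr_gt0 mulr_gt0.
pose S : 'M[N]_(#|T|, n) := \matrix_(i, j) s (r i) (b j k).
pose C : 'M[N]_(n, \dim {:F}) := \matrix_(i, j) (c j i k)%:A.
pose X : 'M[N]_(\dim {:F}, #|T|) := \matrix_(j, i) invmx M j (r i).
pose E := (rowsub r M - S *m C) *m X.
have MX : rowsub r M *m X = 1%:M.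
  have -> : X = colsub r (invmx M) by apply/matrixP => i j; rewrite !mxE.
  by rewrite mul_rowsub_mx mulmx_colsub mulmxV // ; apply/matrixP => i j;
    rewrite !mxE (inj_eq enum_val_inj).
have Esmall i j : w (E i j) < #|T|%:R^-1.
  rewrite mxE; apply: le_lt_trans (absv_sum hw.1 _ _ _) _.
  apply: (@le_lt_trans _ _ (\sum_l (#|T|%:R * B)^-1 * w (invmx M l (r j)))).
    apply: ler_sum => l _; rewrite (absvM hw.1) !mxE.
    rewrite ler_wpM2r ?(absv_ge0 hw.1) //.
    have -> : \sum_j0 S i j0 * C j0 l = s (r i) (\sum_(i < n) c l i k *: b i k).
      rewrite rmorph_sum; apply: eq_bigr => j0 _.
      by rewrite !mxE /= fmorph_numZ mulr_algr.
    by rewrite -rmorphB rE ltW // hk // mem_enum.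
  rewrite -mulr_sumr invfM -mulrA gtr_pMr ?invr_gt0 // ltr_pdivrMl // mulr1.
  apply: (@le_lt_trans _ _ (\sum_j \sum_l w (invmx M j l))); last by rewrite /B ltrDr.
  apply: ler_sum => l _; rewrite (bigD1 (r j)) //= lerDl.
  by rewrite sumr_ge0 // => l' _; exact: absv_ge0 hw.1 _.
(* The product factors through dimension [n < #|T|], so some row [z <> 0] is killed by it and
   satisfies [z = z *m E]. At the coordinate of [z] of largest absolute value, the smallness of [E]
   makes this impossible. *)
have : kermx (S *m (C *m X)) != 0.
  by rewrite kermx_eq0 /row_free neq_ltn (leq_ltn_trans (mulmx_max_rank _ _)).
case/rowV0Pn => z /sub_kermxP zK z0.
have zE : z = z *m E.
  by rewrite /E mulmxBl MX mulmxBr mulmx1 -mulmxA zK subr0.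
have [i1 hi1] : exists i1, forall i, w (z 0 i) <= w (z 0 i1).
  pose i1 : 'I_#|T| := Ordinal nT.
  case: (@arg_maxP _ _ 'I_#|T| i1 xpredT (fun i => w (z 0 i))) => // i2 _ hi.
  by exists i2 => i; apply: hi.
have w0 : 0 < w (z 0 i1).
  rewrite lt_def (absv_ge0 hw.1) andbT; apply: contra z0 => /eqP w0.
  apply/eqP/rowP => i; apply/eqP; rewrite mxE -(absv_eq0 hw.1) eq_le.
  by rewrite (absv_ge0 hw.1) andbT -w0 hi1.
suff : w (z 0 i1) < w (z 0 i1) by rewrite ltxx.
rewrite {1}zE mxE; apply: le_lt_trans (absv_sum hw.1 _ _ _) _.
apply: (@lt_le_trans _ _ (\sum_(i < #|T|) w (z 0 i1) * #|T|%:R^-1)); last first.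
  by rewrite sumr_const card_ord -(mulr_natr (_ * _)) divfK // gt_eqF.
apply: ltr_sum => [|i _]; first by apply/hasP; exists i1; rewrite ?mem_index_enum.
rewrite (absvM hw.1); apply: le_lt_trans (_ : w (z 0 i1) * w (E i i1) < _).
  by rewrite ler_wpM2r ?(absv_ge0 hw.1).
by rewrite ltr_pM2l.
Qed.

(** The existence of a basis excludes the default value 0 of [local_degree]; the cardinality bound
    then applies to whichever basis size [xget] selects. *)
Lemma local_degree_ge (v : F -> R) :
  (#|[pred i | (w \o s i : F -> R) == v]| <= local_degree v)%N.
Proof.
set T := [pred i | _].
have [i0 i0T|T0] := pickP T; last by rewrite eq_card0.
have vE : v = w \o s i0 by move/eqP: i0T.
have pv : place_over P v by rewrite vE; exact: place_over_comp.
have [m [b' hb]] := completion_basis_exists pv.1 (completion_spanned_vbasis vE).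
rewrite /local_degree; case: xgetP => [n -> [b [cb sb _]]|/(_ m)].
  by apply: (completion_basis_card (b := b)); split.
by case; exists b'.
Qed.

End LocalDegree.

(** * Places and the lower bound for the height *)

(* The constant [C] in [v (x + y) <= C * max(v x, v y)]. *)
Definition add_const (R : realType) (P : option nat) : R :=
  if P is Some _ then 1 else 2.

Lemma add_const_ge1 (R : realType) P : 1 <= add_const R P.
Proof. by case: P => //=; rewrite ler1n. Qed.

Section Places.
Variables (R : realType) (F : fieldExtType rat).
Implicit Types v : F -> R.

Lemma place_over_nat p v : prime p -> place_over (Some p) v ->
  forall n, v n%:R <= 1.
Proof.
move=> pp [_ hv] n; have := hv n%:R; rewrite scaler_nat => ->.
exact: (padic_abs_int_le1 R n pp).
Qed.

Lemma place_overD P v x y : rat_place P -> place_over P v ->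
  v (x + y) <= add_const R P * Num.max (v x) (v y).
Proof.
case: P => [p|] /= hP pv.
  by rewrite mul1r; apply: (absv_ultrametric pv.1); exact: (place_over_nat hP pv).
apply: le_trans (absvD pv.1 x y) _.
by rewrite mulr_natl mulr2n lerD // le_max lexx ?orbT.
Qed.

Lemma place_overD_nonarch p v x y (B : R) : prime p -> place_over (Some p) v ->
  v x <= B -> v y <= B -> v (x + y) <= B.
Proof.
move=> pp pv xB yB; have := @place_overD (Some p) v x y pp pv.
by rewrite mul1r => /le_trans; apply; rewrite ge_max xB.
Qed.

Lemma place_over_sum_nonarch p v (pp : prime p) (pv : place_over (Some p) v)
    (I : Type) (r : seq I) (Q : pred I) (f : I -> F) (B : R) :
  0 <= B -> (forall i, Q i -> v (f i) <= B) -> v (\sum_(i <- r | Q i) f i) <= B.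
Proof.
move=> B0 h; elim/big_ind: _ => [|x y|//]; first by rewrite (absv0 pv.1).
exact: (place_overD_nonarch pp pv).
Qed.

(** The value at the integer [p] tells the places apart: it is below 1 over [p], equal to 1 over
    another prime, and [p] itself over the archimedean place. *)
Lemma place_over_uniq P Q v : rat_place P -> rat_place Q ->
  place_over P v -> place_over Q v -> P = Q.
Proof.
have step p Q' : prime p -> rat_place Q' -> place_over (Some p) v ->
    place_over Q' v -> Some p = Q'.
  move=> pp hQ [_ h1] [_ h2].
  have : rat_abs R (Some p) p%:R = rat_abs R Q' p%:R by rewrite -h1 -h2.
  have p1 : p%:R^-1 < 1 :> R.
    by rewrite invf_lt1 ?ltr1n ?prime_gt1 // ltr0n prime_gt0.
  rewrite /= padic_abs_prime //; case: Q' hQ {h2} => [q|] /= hQ e.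
    have [->//|pq] := eqVneq p q.
    suff e1 : padic_abs R q p%:R = 1 by rewrite e e1 ltxx in p1.
    apply: (@padic_abs_int_eq1 R q p) => //.
    by rewrite dvdzE /= dvdn_prime2 // eq_sym.
  rewrite e ger0_norm ?ler0n // ratr_nat ltNge ler1n prime_gt0 // in p1.
case: P Q => [p|] [q|] hP hQ h1 h2 //; [exact: step|exact: step|].
exact/esym/step.
Qed.

(* Elements that are close to 1 at one place and small at the other ones are
   linearly independent over Q. *)
Lemma finite_places_over P : rat_place P -> finite_set [set v | @place_over R F P v].
Proof.
move=> hP; apply: contrapT => /(infinite_set_fset (\dim {:F}).+1)[B BP].
set r := finmap.enum_fset B => sr.
have ur : uniq r := finmap.fset_uniq B.
have rP v : v \in r -> place_over P v by move=> vr; apply: BP.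
pose d := size r; pose vs (i : 'I_d) := tnth (in_tuple r) i.
have vsP i : place_over P (vs i) by apply: rP; exact: mem_tnth.
have vs_inj i j : i != j -> vs i <> vs j.
  move=> ij e; case/eqP: ij; apply/val_inj/eqP.
  have := e; rewrite {1 2}/vs !(tnth_nth (vs i)) /= => e'.
  by rewrite -(nth_uniq (vs i) _ _ ur) ?e'.
have d0 : 0 < (d%:R : R) by rewrite ltr0n (leq_trans _ sr).
(* In a relation between the [x i], take the coefficient of largest absolute value [a i]. Its term
   exceeds [a i / 2], while the others add up to at most [d] times [a i / (2 d)]; hence the two
   constants. *)
have /choice[x hx] i : exists x, vs i (x - 1) < 2^-1 /\
    forall j, j != i -> vs j x < (2 * d%:R)^-1.
  have [|||x [x1 x2]] := weak_approximation hP (v0 := vs i)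
      (s := [seq vs j | j <- enum 'I_d & j != i]) 1 (e := (2 * d%:R)^-1).
  - exact: vsP.
  - move=> v /mapP[j]; rewrite mem_filter => /andP[ji _] ->.
    by split; [exact: vsP|exact: vs_inj].
  - by rewrite invr_gt0 mulr_gt0.
  exists x; split=> [|j ji].
    rewrite (lt_le_trans x1) // lef_pV2 ?posrE ?mulr_gt0 // ler_peMr // ler1n.
    by rewrite (leq_trans _ sr).
  by apply: x2; apply/mapP; exists j; rewrite // mem_filter ji mem_enum.
pose A : 'M[rat]_(d, \dim {:F}) := \matrix_(i, j) coord (vbasis {:F}) j (x i).
have : kermx A != 0.
  by rewrite kermx_eq0 /row_free neq_ltn (leq_ltn_trans (rank_leq_col _)).
case/rowV0Pn => c /sub_kermxP cA c0.
have cx : \sum_i c 0 i *: x i = 0.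
  rewrite (coord_vbasis (memvf (\sum_i c 0 i *: x i))) big1 // => j _.
  have := congr1 (fun B : 'rV_(\dim {:F}) => B 0 j) cA; rewrite !mxE => cAj.
  rewrite linear_sum (_ : \sum_i _ = 0) ?scale0r // -[RHS]cAj.
  by apply: eq_bigr => i _; rewrite linearZ mxE.
have [i0 ci0] : exists i0, c 0 i0 != 0 by apply/rV0Pn.
pose a i := rat_abs R P (c 0 i).
have aE i j : a i = vs j (c 0 i)%:A by rewrite (vsP j).2.
case: (@arg_maxP _ _ 'I_d i0 xpredT a) => // i _ hi.
have ai : 0 < a i.
  apply: lt_le_trans (hi i0 isT).
  by rewrite (aE _ i0) (absv_gt0 (vsP _).1) scaler_eq0 negb_or ci0 oner_eq0.
have hv := (vsP i).1.
have e1 : c 0 i *: x i = - \sum_(j | j != i) c 0 j *: x j.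
  by move: cx; rewrite (bigD1 i) //= => /eqP; rewrite addr_eq0 => /eqP.
have l1 : a i * 2^-1 < vs i (c 0 i *: x i).
  rewrite -mulr_algl (absvM hv) -aE ltr_pM2l //.
  have := absv_lerB hv 1 (x i); rewrite (absv1 hv) (absvBC hv).
  have := (hx i).1; lra.
have l2 : vs i (c 0 i *: x i) <= a i * 2^-1.
  rewrite e1 (absvN hv) (le_trans (absv_sum hv _ _ _)) //.
  apply: (@le_trans _ _ (\sum_(j < d) a i * (2 * d%:R)^-1)).
    rewrite [X in _ <= X](bigD1 i) //= ler_wpDl //.
      by rewrite mulr_ge0 ?ltW // invr_gt0 mulr_gt0.
    apply: ler_sum => j ji; rewrite -mulr_algl (absvM hv) -aE.
    rewrite ler_pM ?(absv_ge0 hv) //; first by rewrite (aE _ i) (absv_ge0 hv).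
      exact: hi.
    by apply/ltW/(hx j).2; rewrite eq_sym.
  rewrite sumr_const card_ord -(mulr_natr (_ * _)) invfM -!mulrA mulVf ?mulr1 //.
  by rewrite gt_eqF.
by have := lt_le_trans l1 l2; rewrite ltxx.
Qed.

(** If [v x > 1], the leading term would be larger than every other term of the equation. *)
Lemma place_over_le1_integral p v (q : {poly rat}) x : prime p ->
    place_over (Some p) v -> q \is monic -> (forall i, padic_abs R p q`_i <= 1) ->
  root (map_poly (in_alg F) q) x -> v x <= 1.
Proof.
move=> pp pv mq hq /rootP qx; have hv := pv.1.
rewrite leNgt; apply/negP => x1.
have vx0 : 0 < v x by apply: lt_trans x1.
pose n := (size q).-1.
have sq : size (map_poly (in_alg F) q) = n.+1.
  by rewrite size_map_poly prednK // lt0n size_poly_eq0 monic_neq0.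
have : x ^+ n = - \sum_(i < n) (q`_i)%:A * x ^+ i.
  apply/eqP; rewrite -addr_eq0 addrC; apply/eqP; rewrite -{}[RHS]qx horner_coef sq.
  rewrite big_ord_recr /= coef_map /= -/(lead_coef q) (monicP mq) scale1r mul1r.
  by congr (_ + _); apply: eq_bigr => i _; rewrite coef_map.
case en : n => [|m].
  rewrite big_ord0 oppr0 expr0 => /eqP; by rewrite oner_eq0.
move=> e; have : v (x ^+ m.+1) <= v x ^+ m.
  rewrite e (absvN hv). apply: (place_over_sum_nonarch pp pv).
    by rewrite exprn_ge0 // ltW.
  move=> i _; rewrite (absvM hv) (absvX hv) pv.2 -[X in _ <= X]mul1r.
  apply: ler_pM; rewrite ?exprn_ge0 ?(ltW vx0) //.
  - by rewrite -[X in 0 <= X](pv.2) (absv_ge0 hv).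
  - exact: hq.
  - by rewrite ler_weXn2l ?(ltW x1) // -ltnS.
by rewrite (absvX hv) exprS leNgt ltr_pMl ?x1 // exprn_gt0.
Qed.

End Places.

Lemma padic_abs_le1 (R : realType) p (q : rat) : prime p ->
  ~~ (p %| `|denq q|)%N -> padic_abs R p q <= 1.
Proof.
move=> pp pq; have [->|q0] := eqVneq q 0; first by rewrite padic_abs0.
rewrite /padic_abs (negPf q0) logn_coprime ?prime_coprime // expr0 mul1r.
rewrite invf_le1 ?exprn_gt0 ?exprn_ege1 ?ltr0n ?ler1n ?prime_gt0 //.
Qed.

Lemma dvdn_denq_numq p (q : rat) : prime p ->
  (p %| `|denq q|)%N -> ~~ (p %| `|numq q|)%N.
Proof.
move=> pp pd; apply/negP => pn; move: (prime_gt1 pp).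
suff : (p %| 1)%N by rewrite dvdn1 => /eqP ->.
by rewrite -(eqP (coprime_num_den q)) dvdn_gcd pn.
Qed.

(** A prime larger than the sum of the denominators of the minimal polynomial divides none of
    them. *)
Lemma eventually_integral (F : fieldExtType rat) (x : F) : exists B, forall (R : realType)
  p (v : F -> R), prime p -> (B < p)%N -> place_over (Some p) v -> v x <= 1.
Proof.
have [q [mq eq _]] := rat_minPolyP x.
exists (\sum_(i < size q) `|denq q`_i|)%N => R p v pp Bp pv.
apply: (place_over_le1_integral pp pv mq); last by rewrite -eq root_minPoly.
move=> i; have [iq|iq] := ltnP i (size q); last by rewrite nth_default ?padic_abs0.
apply: padic_abs_le1 => //; rewrite gtnNdvd ?absz_gt0 ?denq_eq0 //.
by apply: leq_ltn_trans Bp; rewrite (bigD1 (Ordinal iq)) //= leq_addr.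
Qed.

Lemma finite_places_gt1 (R : realType) (F : fieldExtType rat) (x : F) :
  finite_set [set v | @places R F v /\ 1 < v x].
Proof.
have [B hB] := eventually_integral x.
(* Index 0 stands for the archimedean place and [j.+1] for [j]; a prime [p <= B] has index
   [p.+1 < B.+2]. *)
apply: (@sub_finite_set _ _ (\bigcup_(i in [set i | (i < B.+2)%N])
    [set v | rat_place (if i is j.+1 then Some j else None) /\
       @place_over R F (if i is j.+1 then Some j else None) v])).
  move=> v [[hv [h|[p pp h]]] vx] /=; first by exists 0%N.
  exists p.+1 => //=; rewrite ltnS ltnS leqNgt; apply/negP => pB.
  by have := hB R p v pp pB (conj hv h); rewrite leNgt vx.
apply: bigcup_finite => [|i _]; first exact: finite_II.
case e : (rat_place (if i is j.+1 then Some j else None)).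
  by apply: sub_finite_set (finite_places_over R F e) => v [].
by apply: sub_finite_set (finite_set0 _) => v [].
Qed.

(** The power [\dim {:F}] clears the denominators of the exponents in the height. Grouping the
    left-hand factors by the place [v] they induce, [max(1, v x)] occurs as often as there are
    embeddings inducing [v], which [local_degree_ge] bounds. Only the finitely many [v] with
    [v x > 1] matter. *)
Lemma height_ge_prod (R : realType) (F N : fieldExtType rat) (Ps : seq (option nat))
    (w : option nat -> N -> R) (s : 'I_(\dim {:F}) -> {rmorphism F -> N}) (x : F) :
    uniq Ps -> (forall P, P \in Ps -> rat_place P /\ place_over P (w P)) ->
    embedding_mx s (fun i => (vbasis {:F})`_i) \in unitmx ->
  \prod_(P <- Ps) \prod_i Num.max 1 (w P (s i x)) <= height_in R x ^+ \dim {:F}.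
Proof.
move=> uPs hPs us; pose A := [set v | @places R F v /\ 1 < v x].
have finA : finite_set A := finite_places_gt1 R x.
set d := \dim {:F}.
have d0 : d%:R != 0 :> R by rewrite pnatr_eq0 -lt0n adim_gt0.
have -> : height_in R x = \prod_(v <- finmap.enum_fset (fset_set A))
    (Num.max 1 (v x) `^ ((local_degree v)%:R / d%:R)).
  rewrite /height_in -(fsbig_finite _ _ finA); apply/esym/fsbig_widen => [v []//|v].
  move=> [pv /not_andP[//|/negP]]; rewrite -leNgt => vx /=.
  by rewrite (max_idPl vx) powR1.
rewrite -prodrXl.
have -> : \prod_(v <- finmap.enum_fset (fset_set A))
      (Num.max 1 (v x) `^ ((local_degree v)%:R / d%:R)) ^+ d
    = \prod_(v <- finmap.enum_fset (fset_set A)) Num.max 1 (v x) ^+ local_degree v.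
  apply: eq_bigr => v _; rewrite -powR_mulrn ?powR_ge0 // -powRrM divfK //.
  by rewrite powR_mulrn // le_max ler01.
have -> : \prod_(P <- Ps) \prod_i Num.max 1 (w P (s i x)) =
   \prod_(P <- Ps) \prod_i \prod_(v <- finmap.enum_fset (fset_set A) |
      v == (w P \o s i : F -> R)) Num.max 1 (v x).
  rewrite !big_seq; apply: eq_bigr => P /hPs[hP hw]; apply: eq_bigr => i _.
  have [iA|niA] := boolP ((w P \o s i : F -> R) \in finmap.enum_fset (fset_set A)).
    rewrite -big_filter (_ : [seq _ <- _ | _] = [:: (w P \o s i : F -> R)]) ?big_seq1 //.
    apply/perm_small_eq => //; apply: uniq_perm; rewrite ?filter_uniq ?finmap.fset_uniq //.
    move=> v; rewrite mem_filter inE; case: eqVneq => [->|//]; by rewrite iA.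
  rewrite big1_seq => [|v /andP[/eqP-> vA]]; last by rewrite vA in niA.
  apply/max_idPl; rewrite leNgt; apply: contra niA => h.
  rewrite in_fset_set // inE; split=> //.
  have := place_over_comp (s i) hw; case: P hP {hw h} => [p|] hP hw; split; rewrite ?hw.1 //.
  - exact: hw.1.
  - by right; exists p => //; exact: hw.2.
  - exact: hw.1.
  - by left; exact: hw.2.
under eq_bigr do under eq_bigr do rewrite big_mkcond /=.
under eq_bigr do rewrite exchange_big /=.
rewrite exchange_big /=; apply: ler_prod => v _; apply/andP; split.
  apply: prodr_ge0 => P _; apply: prodr_ge0 => i _.
  by case: ifP => _ //; rewrite le_max ler01.
have m1 : 1 <= Num.max 1 (v x) by rewrite le_max lexx.
set m := Num.max _ _ in m1 *.
have e P : \prod_(i < d) (if v == w P \o s i then m else 1)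
    = m ^+ #|[pred i | (w P \o s i : F -> R) == v]|.
  by rewrite -big_mkcond /= prodr_const; congr (_ ^+ _); apply: eq_card => i;
    rewrite !inE eq_sym.
under eq_bigr do rewrite e.
(* A place of [F] lies over a single place of Q, so at most one [P] contributes a nontrivial
   power. *)
have [allz|] := boolP (all (fun P => #|[pred i | (w P \o s i : F -> R) == v]| == 0%N) Ps).
  rewrite big1_seq ?exprn_ege1 // => P /andP[_ /(allP allz)/eqP ->].
  by rewrite expr0.
case/allPn => P PPs nz.
have pvP Q : Q \in Ps -> #|[pred i | (w Q \o s i : F -> R) == v]| != 0%N ->
    rat_place Q /\ place_over Q v.
  move=> /hPs[hQ hw]; rewrite -lt0n => /card_gt0P[i /eqP <-].
  by split=> //; exact: place_over_comp.
rewrite (bigD1_seq P) //= big1_seq ?mulr1.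
  have [hP hw] := hPs P PPs.
  by rewrite ler_weXn2l // (local_degree_ge hP hw us).
move=> Q /andP[QP QPs]; have [->|nzQ] := eqVneq
  #|[pred i | (w Q \o s i : F -> R) == v]| 0%N; first by rewrite expr0.
have [hP pP] := pvP P PPs nz; have [hQ pQ] := pvP Q QPs nzQ.
by rewrite (place_over_uniq hQ hP pQ pP) eqxx in QP.
Qed.

(** * Existence of places *)

(* A subring maximal among those that do not contain [t = 1/p] is a valuation
   ring. *)
Section MaximalSubring.
Variables (F : fieldType) (S : subringClosed F) (t : F).
Hypotheses (pS : t^-1 \in S) (tS : t \notin S).
Hypothesis Smax : forall S' : {pred F}, subring_closed S' -> {subset S <= S'} ->
  t \notin S' -> {subset S' <= S}.

Let t0 : t != 0. Proof. by apply: contraNneq tS => ->; exact: rpred0. Qed.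

(** Localize [S] at the powers of [u]. As [u] is 1 modulo [t^-1], so is each power, and [t * u ^+ n]
    in [S] would force [t] in [S]. The localization therefore still misses [t] and equals [S] by
    maximality. *)
Lemma maximal_subring_unit a : a \in S -> (1 - t^-1 * a)^-1 \in S.
Proof.
move=> aS; set u := 1 - _.
have uS : u \in S by rewrite rpredB ?rpred1 // rpredM.
have uX n : exists2 b, b \in S & u ^+ n = 1 - t^-1 * b.
  elim: n => [|n [b bS e]]; first by exists 0; rewrite ?rpred0 // mulr0 subr0.
  exists (a + b - a * b * t^-1).
    by rewrite rpredB ?rpredM // rpredD.
  by rewrite exprS e /u; field.
have u0 : u != 0.
  rewrite subr_eq0; apply: contraNneq tS => e.
  by rewrite -[t]mulr1 e mulrA divff // mul1r.
pose S' : {pred F} := fun x => `[< exists n, x * u ^+ n \in S >].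
have hS' : subring_closed S'.
  split=> [|x y /asboolP[n hn] /asboolP[m hm]|x y /asboolP[n hn] /asboolP[m hm]].
  - by apply/asboolP; exists 0%N; rewrite expr0 mulr1 rpred1.
  - apply/asboolP; exists (n + m)%N.
    have -> : (x - y) * u ^+ (n + m) = (x * u ^+ n) * u ^+ m - (y * u ^+ m) * u ^+ n.
      by rewrite exprD; ring.
    by apply: rpredB; apply: rpredM; rewrite ?rpredX.
  - apply/asboolP; exists (n + m)%N.
    have -> : x * y * u ^+ (n + m) = (x * u ^+ n) * (y * u ^+ m).
      by rewrite exprD; ring.
    by rewrite rpredM.
apply: (Smax hS') => [x xS||].
- by apply/asboolP; exists 0%N; rewrite expr0 mulr1.
- apply/negP => /asboolP[n]; have [b bS ->] := uX n.
  rewrite mulrBr mulr1 mulrA divff // mul1r => h; case/negP: tS.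
  by rewrite -[t](subrK b) rpredD.
- by apply/asboolP; exists 1%N; rewrite expr1 mulVf ?rpred1.
Qed.

(* If neither [x] nor [x^-1] were in [S], both would satisfy relations
   [1 = p q(x)], and each relation could be used to lower the degree of the other. *)
Let unit_relation x n := exists q : {poly F},
  [/\ q \is a polyOver S, (size q <= n.+1)%N & t^-1 * q.[x] = 1].

(** The ring [S[x]] is strictly larger than [S], hence contains [t]; the relation is [t = q(x)]
    divided by [t]. *)
Lemma maximal_subring_adjoin x : x \notin S -> exists n, unit_relation x n.
Proof.
move=> xS; pose S' : {pred F} := fun y => `[< exists2 q, q \is a polyOver S & y = q.[x] >].
have hS' : subring_closed S'.
  split=> [|y z /asboolP[q qS ->] /asboolP[r rS ->]|y z /asboolP[q qS ->] /asboolP[r rS ->]].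
  - by apply/asboolP; exists 1; rewrite ?rpred1 // hornerC.
  - by apply/asboolP; exists (q - r); rewrite ?rpredB // hornerD hornerN.
  - by apply/asboolP; exists (q * r); rewrite ?rpredM // hornerM.
have : t \in S'.
  apply: contraNT xS => tS'; apply: (Smax hS') => // [y yS|].
    by apply/asboolP; exists y%:P; rewrite ?polyOverC // hornerC.
  by apply/asboolP; exists 'X; rewrite ?polyOverX // hornerX.
case/asboolP => q qS tq; exists (size q), q; split=> //.
by rewrite -tq mulVf.
Qed.

Lemma maximal_subring_reduce x n m : x != 0 -> (m <= n)%N ->
  unit_relation x n -> unit_relation x^-1 m -> exists2 n', (n' < n)%N & unit_relation x n'.
Proof.
move=> x0 mn [q [qS sq eq]] [r [rS sr er]].
case: n mn sq => [|n] mn sq.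
  have e := size1_polyC sq; move: eq; rewrite e hornerC => eq.
  case/negP: tS; rewrite -[t]mulr1 -eq mulrA divff // mul1r.
  exact: (polyOverP qS).
have uS : (1 - t^-1 * r`_0)^-1 \in S.
  by apply: maximal_subring_unit; exact: (polyOverP rS).
set u := 1 - _ in uS.
have u0 : u != 0.
  rewrite subr_eq0; apply: contraNneq tS => e.
  by rewrite -[t]mulr1 e mulrA divff // mul1r (polyOverP rS).
(* In the relation for [x^-1] the constant term is moved to the other side, where it forms the unit
   [u]. Dividing by [u] and multiplying by [x ^+ n.+1] gives [x ^+ n.+1 = t^-1 * r'.[x]] with [r']
   of degree at most [n], which then replaces the top power in [q]. *)
pose r' := \sum_(j < n.+1) (u^-1 * r`_j.+1) *: 'X^(n - j) : {poly F}.
have r'S : r' \is a polyOver S.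
  apply: rpred_sum => j _; apply/polyOverP => i; rewrite coefZ coefXn.
  by rewrite rpredM ?rpred_nat // rpredM // (polyOverP rS).
have sr' : (size r' <= n.+1)%N.
  apply: (leq_trans (size_sum _ _ _)); apply/bigmax_leqP => j _.
  apply: leq_trans (size_scale_leq _ _) _.
  by rewrite size_polyXn ltnS leq_subr.
have er' : t^-1 * r'.[x] = x ^+ n.+1.
  have e1 : u = t^-1 * \sum_(j < n.+1) r`_j.+1 * x^-1 ^+ j.+1.
    have szr : (size r <= n.+2)%N by apply: leq_trans sr _.
    move: er; rewrite (horner_coef_wide _ szr) big_ord_recl expr0 mulr1 mulrDr => er.
    by rewrite /u -er addrC addKr.
  have -> : x ^+ n.+1 = u^-1 * (t^-1 * (\sum_(j < n.+1) r`_j.+1 * x^-1 ^+ j.+1) * x ^+ n.+1).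
    by rewrite -e1 mulKf.
  rewrite horner_sum !mulr_sumr mulr_suml mulr_sumr; apply: eq_bigr => j _.
  rewrite hornerZ hornerXn exprVn.
  have -> : x ^+ n.+1 = x ^+ j.+1 * x ^+ (n - j).
    by rewrite -exprD addSn subnKC // -ltnS.
  by field; rewrite u0 t0 expf_neq0.
exists n => //; exists (take_poly n.+1 q + (t^-1 * q`_n.+1) *: r'); split.
- rewrite rpredD //; apply/polyOverP => i; last first.
    by rewrite coefZ !rpredM ?(polyOverP qS) ?(polyOverP r'S).
  by rewrite coef_take_poly; case: ifP => _; rewrite ?rpred0 ?(polyOverP qS).
- rewrite (leq_trans (size_polyD _ _)) // geq_max size_take_poly.
  by rewrite (leq_trans (size_scale_leq _ _)).
rewrite hornerD hornerZ mulrDr -eq.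
have -> : t^-1 * (t^-1 * q`_n.+1 * r'.[x]) = t^-1 * (q`_n.+1 * x ^+ n.+1).
  by rewrite -er'; ring.
rewrite -mulrDr; congr (_ * _).
rewrite (horner_coef_wide x sq) big_ord_recr /=; congr (_ + _).
rewrite (horner_coef_wide x (size_take_poly _ _)); apply: eq_bigr => i _.
by rewrite coef_take_poly ltn_ord.
Qed.

Lemma maximal_subring_valuation x : x \in S \/ x^-1 \in S.
Proof.
have [->|x0] := eqVneq x 0; first by left; exact: rpred0.
apply: contrapT => /not_orP[/negP xS /negP yS].
have [n hn] := maximal_subring_adjoin xS; have [m hm] := maximal_subring_adjoin yS.
have [k le_k] := ubnP (n + m).
elim: k => // k IH in n m hn hm le_k *.
have [mn|/ltnW nm] := leqP m n.
  have [n' n'n hn'] := maximal_subring_reduce x0 mn hn hm.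
  by apply: (IH n' m) => //; rewrite -ltnS (leq_trans _ le_k) // ltnS ltn_add2r.
rewrite -[x]invrK in hn.
have [m' m'm hm'] := maximal_subring_reduce (invr_neq0 x0) nm hm hn.
apply: (IH n m') => //; first by rewrite invrK in hn.
by rewrite -ltnS (leq_trans _ le_k) // ltnS ltn_add2l.
Qed.

End MaximalSubring.

(** The minimal polynomial of a generator has a root in the algebraically closed field [R[i]]; the
    place is the modulus of the resulting embedding. *)
Lemma place_exists_arch (R : realType) (F : fieldExtType rat) :
  exists v : F -> R, place_over None v.
Proof.
have [t gen_t] := primitive_element_rat F.
have [q [mq eq _]] := rat_minPolyP t.
have sq : size (map_poly (@ratr (R[i])%C) q) != 1%N.
  rewrite size_map_poly; have := size_minPoly 1%AS t.
  rewrite eq size_map_poly => ->; rewrite eqSS -lt0n.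
  by rewrite adjoin_degreeE divn_gt0 ?adim_gt0 // dimvS // subv_adjoin.
have [z qz] := closed_rootP _ sq.
have [f _] := rmorphism_of_root gen_t eq qz.
exists (fun x => Normc.normc (f x)); split; first split.
- by move=> x; case: (f x) => a b; exact: sqrtr_ge0.
- move=> x; split=> [/Normc.eq0_normc/eqP|->].
    by rewrite fmorph_eq0 => /eqP.
  by rewrite rmorph0 Normc.normc0.
- by move=> x y; rewrite rmorphM Normc.normcM.
- by move=> x y; rewrite rmorphD le_normcD.
move=> a; rewrite /= alg_num_field fmorph_rat.
have -> : ratr a = (ratr a : R)%:C%C :> (R[i])%C by rewrite fmorph_rat.
by rewrite /= expr0n /= addr0 sqrtr_sqr ratr_norm.
Qed.

(** * The absolute value attached to a valuation ring over p *)

Section PadicPlace.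
Variables (R : realType) (F : fieldExtType rat) (p : nat) (S : subringClosed F).
Hypothesis pp : prime p.
Hypothesis S_rat : forall a : rat, (a%:A \in S) = (padic_abs R p a <= 1).
Hypothesis S_val : forall x, x \in S \/ x^-1 \in S.

Let unitS x := (x \in S) && (x^-1 \in S).

Let unitSM x y : unitS x -> unitS y -> unitS (x * y).
Proof.
move=> /andP[x1 x2] /andP[y1 y2].
by rewrite /unitS invfM !rpredM.
Qed.

Let unitSV x : unitS x -> unitS x^-1.
Proof. by rewrite /unitS invrK andbC. Qed.

Let unitSX x n : unitS x -> unitS (x ^+ n).
Proof.
move=> /andP[x1 x2].
by rewrite /unitS -exprVn !rpredX.
Qed.

Let S_ratM (a b : rat) : a%:A * b%:A = (a * b)%:A :> F.
Proof. by rewrite -!in_algE rmorphM. Qed.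

Let S_ratV (a : rat) : (a%:A)^-1 = (a^-1)%:A :> F.
Proof. by rewrite -!in_algE fmorphV. Qed.

Let S_ratX (a : rat) n : (a%:A) ^+ n = (a ^+ n)%:A :> F.
Proof. by rewrite -!in_algE rmorphXn. Qed.

Let padicV (a : rat) : padic_abs R p a^-1 = (padic_abs R p a)^-1.
Proof.
have [->|a0] := eqVneq a 0; first by rewrite invr0 padic_abs0 invr0.
have n0 : padic_abs R p a != 0 by rewrite gt_eqF // padic_abs_gt0.
apply: (mulfI n0); rewrite -padic_absM // !divff //.
have := padic_absE R pp (oner_neq0 int) (oner_neq0 int).
by rewrite divr1 logn1 expr0 divr1.
Qed.

Let padicX (a : rat) n : padic_abs R p (a ^+ n) = padic_abs R p a ^+ n.
Proof.
elim: n => [|n IH]; last by rewrite !exprS padic_absM // IH.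
have := padic_absE R pp (oner_neq0 int) (oner_neq0 int).
by rewrite divr1 logn1 expr0 divr1 expr0.
Qed.

Let unit_rat (a : rat) : a != 0 -> unitS a%:A -> padic_abs R p a = 1.
Proof.
move=> a0; rewrite /unitS S_ratV !S_rat padicV => /andP[a1].
rewrite invf_le1 ?padic_abs_gt0 // => a2.
by apply/le_anti; rewrite a1 a2.
Qed.

(* [r] is the value of [x] when [x ^+ m] is a unit times a rational of absolute
   value [r ^+ m]. *)
Let value (x : F) (r : R) := [/\ x != 0, 0 < r & exists m, exists a : rat,
  [/\ (0 < m)%N, a != 0, unitS (x ^+ m / a%:A) & r ^+ m = padic_abs R p a]].

Let value_uniq x r r' : value x r -> value x r' -> r = r'.
Proof.
move=> [x0 r0 [m [a [m0 a0 ua ra]]]] [_ r'0 [m' [a' [m'0 a'0 ua' ra']]]].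
have : unitS ((a ^+ m' / a' ^+ m)%:A).
  have -> : (a ^+ m' / a' ^+ m)%:A = (x ^+ m' / a'%:A) ^+ m / (x ^+ m / a%:A) ^+ m' :> F.
    have nz (b : rat) : b != 0 -> b%:A != 0 :> F by rewrite -in_algE fmorph_eq0.
    rewrite -S_ratM -S_ratV -!S_ratX !expr_div_n -!exprM mulnC invfM invrK.
    rewrite mulrACA -mulrA [RHS]mulrA mulfV ?mul1r 1?mulrC //.
      by rewrite expf_neq0.
  by rewrite unitSM ?unitSV ?unitSX.
move/unit_rat; rewrite mulf_neq0 ?invr_eq0 ?expf_neq0 // => /(_ isT).
rewrite padic_absM // padicV !padicX -ra -ra' -!exprM mulnC => e.
apply/eqP; rewrite -(@eqrXn2 _ (m' * m)) ?muln_gt0 ?m0 ?m'0 ?ltW //; apply/eqP.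
by apply: divr1_eq; exact: e.
Qed.

Let valueM x y r r' : value x r -> value y r' -> value (x * y) (r * r').
Proof.
move=> [x0 r0 [m [a [m0 a0 ua ra]]]] [y0 r'0 [m' [a' [m'0 a'0 ua' ra']]]].
split; [by rewrite mulf_neq0|by rewrite mulr_gt0|].
exists (m * m')%N, (a ^+ m' * a' ^+ m); split.
- by rewrite muln_gt0 m0.
- by rewrite mulf_neq0 ?expf_neq0.
- have -> : (x * y) ^+ (m * m') / (a ^+ m' * a' ^+ m)%:A =
     (x ^+ m / a%:A) ^+ m' * (y ^+ m' / a'%:A) ^+ m.
    rewrite -S_ratM -!S_ratX !expr_div_n exprMn -!exprM [(m' * m)%N]mulnC.
    by rewrite invfM mulrACA.
  by rewrite unitSM ?unitSX.
rewrite padic_absM // !padicX -ra -ra' -!exprM exprMn.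
by rewrite [(m' * m)%N]mulnC.
Qed.

Let value_rat (a : rat) : a != 0 -> value a%:A (padic_abs R p a).
Proof.
move=> a0; have aA : a%:A != 0 :> F by rewrite -in_algE fmorph_eq0.
split; rewrite ?padic_abs_gt0 //; exists 1%N, a; split; rewrite ?expr1 //.
by rewrite divff // /unitS invr1 rpred1.
Qed.

Let value_le1 x r : value x r -> (r <= 1) = (x \in S).
Proof.
move=> [x0 r0 [m [a [m0 a0 /andP[ua1 ua2] ra]]]].
have aA : a%:A != 0 :> F by rewrite -in_algE fmorph_eq0.
rewrite -(@expr_le1 _ m) ?(ltW r0) // ra -S_rat.
apply/idP/idP => [aS|xS].
  have xm : x ^+ m \in S by rewrite -[x ^+ m](divfK aA) rpredM.
  (* A valuation ring is integrally closed: [x] is [x ^+ m] times a power of [x^-1]. *)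
  have [//|xV] := S_val x.
  case: m m0 xm {ra ua1 ua2} => // m _ xm.
  have -> : x = x ^+ m.+1 * x^-1 ^+ m.
    by rewrite exprS -mulrA -exprMn divff // expr1n mulr1.
  by apply: rpredM => //; exact: rpredX.
have -> : a%:A = (x ^+ m / a%:A)^-1 * x ^+ m.
  by rewrite invf_div divfK // expf_neq0.
by apply: rpredM => //; exact: rpredX.
Qed.

(** The maximal ideal of the valuation ring. *)
Let nonunit x := x \in S /\ (x != 0 -> x^-1 \notin S).

(** One of the two elements divides the other, say [b] divides [a]; if [a + b] were invertible in
    [S], its divisor [b] would be too. *)
Let nonunitD x y : nonunit x -> nonunit y -> nonunit (x + y).
Proof.
have wl a b : a / b \in S -> nonunit a -> nonunit b -> nonunit (a + b).
  move=> abS [aS na] [bS nb]; split=> [|ab0]; first exact: rpredD.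
  have [b0|b0] := eqVneq b 0.
    by rewrite b0 addr0 in ab0 *; exact: na.
  apply: contra (nb b0) => h.
  have -> : b^-1 = (1 + a / b) * (a + b)^-1 by field; rewrite b0 ab0.
  by rewrite rpredM // rpredD ?rpred1.
move=> nx ny; have [|] := S_val (x / y); first by move/wl; apply.
by rewrite invf_div addrC => /wl; apply.
Qed.

Let S_max (s : seq F) : (forall x, x \in s -> x != 0) -> s != [::] ->
  exists2 y, y \in s & forall x, x \in s -> x / y \in S.
Proof.
elim: s => // a [|b s] IH hs _.
  exists a => [|x]; rewrite ?mem_head // inE => /eqP->.
  by rewrite divff ?rpred1 // hs ?mem_head.
have [x xs|//|y ys hy] := IH; first by apply: hs; rewrite inE xs orbT.
have y0 : y != 0 by apply: hs; rewrite inE ys orbT.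
have a0 : a != 0 by apply: hs; rewrite mem_head.
have [ayS|] := S_val (a / y).
  exists y => [|x]; first by rewrite inE ys orbT.
  by rewrite inE => /orP[/eqP->//|/hy].
rewrite invf_div => yaS; exists a => [|x]; first by rewrite mem_head.
rewrite inE => /orP[/eqP->|/hy xyS]; first by rewrite divff ?rpred1.
by rewrite -[x](divfK y0) -(mulrA (x / y)); apply: rpredM.
Qed.

(** In the minimal equation of [x], let [T i] be a nonzero term dividing all the others. If no other
    term were a unit multiple of it, dividing by [T i] would write -1 as a sum of nonunits. Two
    terms that differ by a unit make a positive power of [x] a unit times a rational, and the value
    is a real root of the p-adic value of that rational. *)
Let value_exists x : x != 0 -> exists r, value x r.
Proof.
move=> x0; have [q [mq eq _]] := rat_minPolyP x.
have qx : \sum_(i < size q) (q`_i)%:A * x ^+ i = 0.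
  have := root_minPoly 1%AS x; rewrite eq => /rootP.
  rewrite horner_coef size_map_poly => e; rewrite -[RHS]e.
  by apply: eq_bigr => i _; rewrite coef_map.
have nzA (a : rat) : (a%:A == 0 :> F) = (a == 0) by rewrite -in_algE fmorph_eq0.
pose T (i : 'I_(size q)) := (q`_i)%:A * x ^+ i.
have T0 i : (T i == 0) = (q`_i == 0) by rewrite mulf_eq0 expf_eq0 (negPf x0) andbF orbF nzA.
have [i iq hi] : exists2 i, T i != 0 & forall j, T j != 0 -> T j / T i \in S.
  have [y||y] := S_max (s := [seq T i | i <- enum 'I_(size q) & T i != 0]).
  - by case/mapP => j; rewrite mem_filter => /andP[Tj _] ->.
  - have sq : ((size q).-1 < size q)%N by rewrite prednK // lt0n size_poly_eq0 monic_neq0.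
    apply/eqP => e; have : T (Ordinal sq) \in [::].
      rewrite -e map_f // mem_filter mem_enum andbT T0 /=.
      by rewrite -/(lead_coef q) (monicP mq) oner_eq0.
    by [].
  case/mapP => i; rewrite mem_filter => /andP[Ti _] -> h.
  by exists i => // j Tj; apply: h; rewrite map_f // mem_filter Tj mem_enum.
have [j ji] : exists2 j, j != i & (T j != 0) && (T i / T j \in S).
  apply: contrapT => nex.
  have e : \sum_(j | j != i) T j / T i = -1.
    move: qx; rewrite -[X in X = 0]/(\sum_i T i) (bigD1 i) //= => /eqP.
    rewrite addrC addr_eq0 => /eqP qx.
    by rewrite -mulr_suml qx mulNr divff.
  have : nonunit (-1).
    rewrite -e; apply: (big_ind nonunit) => [|a b|j ji].
    - by split; rewrite ?rpred0 ?eqxx.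
    - exact: nonunitD.
    have [Tj|Tj] := eqVneq (T j) 0; first by rewrite Tj mul0r; split; rewrite ?rpred0 ?eqxx.
    split=> [|_]; first exact: hi.
    by rewrite invf_div; apply/negP => h; apply: nex; exists j; rewrite ?Tj.
  case=> _; rewrite oppr_eq0 oner_eq0 => /(_ isT).
  by rewrite invrN invr1 rpredN rpred1.
move=> /andP[Tj TijS].
have key m (a : rat) : (0 < m)%N -> a != 0 -> unitS (x ^+ m / a%:A) -> exists r, value x r.
  move=> m0 a0 u; exists (padic_abs R p a `^ (m%:R^-1)).
  have pa := padic_abs_gt0 R pp a0.
  split; rewrite ?powR_gt0 //; exists m, a; split=> //.
  rewrite -powR_mulrn ?powR_ge0 // -powRrM mulVf ?pnatr_eq0 -?lt0n //.
  by rewrite powRr1 // ltW.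
have q0 k : T k != 0 -> q`_k != 0 by rewrite T0.
have u k l : T k != 0 -> T l != 0 -> (l < k)%N -> unitS (T k / T l) -> exists r, value x r.
  move=> Tk Tl lk ukl; apply: (key (k - l)%N (q`_l / q`_k)); rewrite ?subn_gt0 //.
    by rewrite mulf_neq0 ?invr_eq0 ?q0.
  have -> : x ^+ (k - l) / (q`_l / q`_k)%:A = T k / T l.
    have xk : x ^+ k = x ^+ (k - l) * x ^+ l by rewrite -exprD subnK // ltnW.
    rewrite -S_ratM -S_ratV /T xk; move: (nzA q`_k) (nzA q`_l).
    rewrite (negPf (q0 _ Tk)) (negPf (q0 _ Tl)).
    move: (q`_k)%:A (q`_l)%:A => a b /negbT a0 /negbT b0.
    by field; rewrite expf_neq0 // a0 b0.
  by [].
have [ij|ij|/val_inj e] := ltngtP i j.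
- by apply: (u j i) => //; rewrite /unitS invf_div hi.
- by apply: (u i j) => //; rewrite /unitS invf_div hi // TijS.
by rewrite e eqxx in ji.
Qed.

Lemma padic_place_of_valuation : exists v : F -> R, place_over (Some p) v.
Proof.
have /choice[v hv] (x : F) : exists r, if x == 0 then r = 0 else value x r.
  by have [_|/value_exists//] := eqVneq x 0; exists 0.
have v0 : v 0 = 0 by have := hv 0; rewrite eqxx.
have vx x : x != 0 -> value x (v x) by move=> /negPf x0; have := hv x; rewrite x0.
have vgt0 x : x != 0 -> 0 < v x by move/vx => [].
have vge0 x : 0 <= v x.
  by have [->|/vgt0/ltW//] := eqVneq x 0; rewrite v0.
have vM x y : v (x * y) = v x * v y.
  have [->|x0] := eqVneq x 0; first by rewrite !(mul0r, v0).
  have [->|y0] := eqVneq y 0; first by rewrite !(mulr0, v0).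
  by apply: value_uniq (vx _ _) (valueM (vx _ x0) (vx _ y0)); rewrite mulf_neq0.
have v_le1 x : (v x <= 1) = (x \in S).
  have [->|x0] := eqVneq x 0; first by rewrite v0 ler01 rpred0.
  by rewrite (value_le1 (vx x x0)).
exists v; split; last first.
  move=> a; have [->|a0] := eqVneq a 0; first by rewrite scale0r v0 /= padic_abs0.
  have aA : a%:A != 0 :> F by rewrite -in_algE fmorph_eq0.
  exact: value_uniq (vx _ aA) (value_rat a0).
(* Division by [y] reduces the ultrametric inequality to the stability of [S] under adding 1. *)
have wl x y : v x <= v y -> v (x + y) <= v y.
  have [->|y0] := eqVneq y 0.
    rewrite v0 addr0 => h; exact: h.
  have -> : x + y = y * (x / y + 1) by rewrite mulrDr mulr1 mulrCA divff // mulr1.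
  move=> xy; rewrite vM ler_piMr // v_le1 rpredD ?rpred1 // -v_le1.
  by rewrite -(ler_pM2r (vgt0 _ y0)) mul1r -vM divfK.
split=> // [x|x y].
  split=> [h|->//]; apply/eqP; apply: contraPT h => /vgt0 h /eqP.
  by rewrite gt_eqF.
have [/wl|/ltW/wl] := leP (v x) (v y).
  by move/le_trans; apply; rewrite lerDr.
by rewrite addrC => /le_trans; apply; rewrite lerDl.
Qed.

End PadicPlace.

Lemma place_exists (R : realType) (F : fieldExtType rat) P : rat_place P ->
  exists v : F -> R, place_over P v.
Proof.
case: P => [p|] /= pp; last exact: place_exists_arch.
pose t : F := p%:R^-1.
have p0 : p%:R != 0 :> F.
  by have /pcharf0P -> := pchar0_fieldExt F; rewrite -lt0n prime_gt0.
(* The union of the empty chain is empty and must satisfy [Q], so 1 is required of nonempty sets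
   only. *)
pose Q (A : set F) := [/\ ~ A t, forall x, A x -> A 1,
  forall x y, A x -> A y -> A (x - y) & forall x y, A x -> A y -> A (x * y)].
have [X XQ Xtot|A [[At A1 AB AM] Amax]] := @Zorn_bigcup F Q.
  split=> [[Y XY Yt]|x [Y XY Yx]|x y [Y XY Yx] [Z XZ Zy]|x y [Y XY Yx] [Z XZ Zy]].
  - by case: (XQ _ XY) => /(_ Yt).
  - by exists Y => //; case: (XQ _ XY) => _ /(_ _ Yx).
  - have [YZ|ZY] := Xtot _ _ XY XZ.
      by exists Z => //; case: (XQ _ XZ) => _ _ h _; apply: h => //; exact: YZ.
    by exists Y => //; case: (XQ _ XY) => _ _ h _; apply: h => //; exact: ZY.
  - have [YZ|ZY] := Xtot _ _ XY XZ.
      by exists Z => //; case: (XQ _ XZ) => _ _ _ h; apply: h => //; exact: YZ.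
    by exists Y => //; case: (XQ _ XY) => _ _ _ h; apply: h => //; exact: ZY.
(* The maximal set is not empty, because the image of the integers also satisfies [Q]. *)
have {}A1 : A 1.
  have [[x Ax]|nA] := pselect (exists x, A x); first exact: A1 Ax.
  pose Z : set F := [set n%:~R | n in [set: int]].
  case: (Amax Z).
    split=> [x Ax|h]; first by case: nA; exists x.
    by apply: nA; exists 1; apply: h; exists 1.
  split=> [[n _]|x _|x y [m _ <-] [n _ <-]|x y [m _ <-] [n _ <-]].
  - move/(congr1 (fun y => y * p%:R)); rewrite mulVf // -[p%:R]/(p%:Z%:~R) -intrM.
    have -> : (n * p)%:~R = ((n * p)%:~R : rat)%:A :> F by rewrite alg_num_field ratr_int.
    rewrite -in_algE => /eqP; rewrite fmorph_eq1 -[1]/(1%:~R) eqr_int => /eqP e.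
    have : (`|n| * p)%N = 1%N by rewrite -[p]absz_nat -abszM e.
    move/eqP; rewrite muln_eq1 => /andP[_ /eqP p1].
    by move: (prime_gt1 pp); rewrite p1.
  - by exists 1.
  - by exists (m - n) => //; rewrite rmorphB.
  - by exists (m * n) => //; rewrite rmorphM.
pose S0 : {pred F} := fun x => `[< A x >].
have hS0 : subring_closed S0.
  split=> [|x y /asboolP Ax /asboolP Ay|x y /asboolP Ax /asboolP Ay]; apply/asboolP => //.
    exact: AB.
  exact: AM.
pose S0M := GRing.isSubringClosed.Build F S0 hS0.
have [S SE] : exists S : subringClosed F, forall x, (x \in S) = `[< A x >].
  pose S : subringClosed F := HB.pack S0 S0M.
  by exists S.
have tS : t \notin S by rewrite SE; apply/asboolP.
have pS : t^-1 \in S by rewrite invrK rpred_nat.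
have Smax (S' : {pred F}) : subring_closed S' -> {subset S <= S'} -> t \notin S' ->
    {subset S' <= S}.
  move=> [h1 hB hM] SS' tS' x xS'; rewrite SE; apply/asboolP; apply: contrapT => Ax.
  apply: (Amax [set y | y \in S']).
    split=> [y Ay|h]; last by apply: Ax; exact: h.
    by apply: SS'; rewrite SE; apply/asboolP.
  split=> //; first by move=> h; rewrite h in tS'.
(* A Bezout relation [u b + w p = 1] shows that [u b] is 1 minus a multiple of [p], hence a unit by
   [maximal_subring_unit]. *)
have unit_int (b : int) : ~~ (p%:Z %| b)%Z -> (b%:~R : F)^-1 \in S.
  move=> pb; have : coprimez b p by rewrite coprimezE coprime_sym absz_nat prime_coprime // -dvdzE.
  case/coprimezP => -[u w] /= uw.
  have uw' : 1 - t^-1 * (w%:~R) = (u * b)%:~R :> F.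
    rewrite invrK -[p%:R]/(p%:Z%:~R) -intrM -[1]/(1%:~R) -rmorphB; congr (_%:~R).
    by rewrite -uw (mulrC p%:Z) addrK.
  have wS : (w%:~R : F) \in S by rewrite rpred_int.
  have := maximal_subring_unit pS tS Smax wS; rewrite uw' intrM invfM => h.
  have [b0|b0] := eqVneq (b%:~R : F) 0; first by rewrite b0 invr0 rpred0.
  have [u0|u0] := eqVneq (u%:~R : F) 0.
    case/negP: tS; move: uw'; rewrite intrM u0 mul0r => /eqP; rewrite subr_eq0 => /eqP e.
    by rewrite -[t]mulr1 e mulrA divff ?mul1r // invr_eq0.
  have -> : (b%:~R)^-1 = u%:~R * (u%:~R^-1 / b%:~R) :> F by rewrite mulrA divff // mul1r.
  by rewrite rpredM // rpred_int.
have num_den (a : rat) : (p%:Z %| denq a)%Z -> ~~ (p%:Z %| numq a)%Z.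
  by rewrite !dvdzE; exact: dvdn_denq_numq.
have rat_in (a : rat) : padic_abs R p a <= 1 -> a%:A \in S.
  move=> ha; have -> : a%:A = (numq a)%:~R / (denq a)%:~R :> F.
    by rewrite alg_num_field.
  rewrite rpredM ?rpred_int // unit_int //.
  have [->|a0] := eqVneq a 0.
    by rewrite dvdzE /= gtnNdvd ?prime_gt1.
  apply/negP => pd; move: ha; rewrite /padic_abs (negPf a0) (_ : logn p `|numq a| = 0)%N.
    rewrite expr0 divr1 leNgt exprn_egt1 ?ltr1n ?prime_gt1 //; case/negP.
    by rewrite -lt0n logn_gt0 mem_primes pp absz_gt0 denq_eq0 /= -[p]absz_nat -dvdzE.
  by apply: logn_coprime; rewrite prime_coprime // -[p]absz_nat -dvdzE num_den.
apply: (@padic_place_of_valuation R F p S pp).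
  move=> a; apply/idP/idP => [aS|/rat_in//].
  rewrite leNgt; apply/negP => ha.
  have pd : (p%:Z %| denq a)%Z.
    by apply: contraLR ha => pd; rewrite -leNgt padic_abs_le1.
  have nS := unit_int _ (num_den a pd).
  have n0 : numq a != 0.
    by apply: contraTneq ha => /eqP; rewrite numq_eq0 => /eqP ->; rewrite padic_abs0 -leNgt.
  have nF : (numq a)%:~R != 0 :> F.
    by rewrite -(rmorph_int (in_alg F)) fmorph_eq0 intr_eq0.
  have [d ed] := dvdzP pd.
  have dF : (d%:~R : F) != 0.
    rewrite -(rmorph_int (in_alg F)) fmorph_eq0 intr_eq0.
    by apply: contraTneq pd => d0; move: (denq_neq0 a); rewrite ed d0 mul0r eqxx.
  (* With [denq a = d p] and [numq a] a unit of [S], the membership of [a] would put [1/p] into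
     [S]. *)
  case/negP: tS; have -> : t = a%:A * d%:~R * (numq a)%:~R^-1.
    rewrite alg_num_field /ratr ed intrM -[p%:Z%:~R]/(p%:R : F).
    by rewrite /t; field; rewrite nF dF p0.
  by rewrite !rpredM // rpred_int.
exact: maximal_subring_valuation pS tS Smax.
Qed.

Lemma place_choice (R : realType) (F : fieldExtType rat) :
  exists w : option nat -> F -> R, forall P, rat_place P -> place_over P (w P).
Proof.
have /choice[w hw] (P : option nat) : exists v : F -> R, rat_place P -> place_over P v.
  have [/(place_exists R F)[v hv]|nP] := boolP (rat_place P); first by exists v.
  by exists (fun _ => 0).
by exists w.
Qed.

(** * Unramified composita *)

Lemma place_over_sum_attained (R : realType) (F : fieldExtType rat) p (v : F -> R)
    (pp : prime p) (pv : place_over (Some p) v) n (f : 'I_n -> F) :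
  \sum_i f i != 0 -> exists i, v (\sum_i f i) <= v (f i).
Proof.
case: n f => [|n] f; first by rewrite big_ord0 eqxx.
move=> _; case: (@arg_maxP _ _ 'I_n.+1 ord0 xpredT (fun i => v (f i))) => // i _ hi.
exists i; apply: (place_over_sum_nonarch pp pv); first exact: absv_ge0 pv.1 _.
by move=> j _; exact: hi.
Qed.

Lemma place_over_det_le1 (R : realType) (F : fieldExtType rat) p (v : F -> R)
    (pp : prime p) (pv : place_over (Some p) v) n (A : 'M[F]_n) :
  (forall i j, v (A i j) <= 1) -> v (\det A) <= 1.
Proof.
move=> hA; apply: (place_over_sum_nonarch pp pv) => // s _.
rewrite (absvM pv.1) (absvX pv.1) (absvN pv.1) (absv1 pv.1) expr1n mul1r.
rewrite (absv_prod pv.1); apply: prodr_ile1 => i _.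
by rewrite (absv_ge0 pv.1) hA.
Qed.

Lemma place_over_invmx_le1 (R : realType) (F : fieldExtType rat) p (v : F -> R)
    (pp : prime p) (pv : place_over (Some p) v) n (A : 'M[F]_n) :
    (forall i j, v (A i j) <= 1) -> v (\det A) = 1 ->
  forall i j, v (invmx A i j) <= 1.
Proof.
move=> hA dA i j; rewrite /invmx; case: ifP => // _; rewrite !mxE.
rewrite (absvM pv.1) (absvV pv.1) dA invr1 mul1r /cofactor.
rewrite (absvM pv.1) (absvX pv.1) (absvN pv.1) (absv1 pv.1) expr1n mul1r.
by apply: (place_over_det_le1 pp pv) => k l; rewrite !mxE.
Qed.

Lemma galois_rat (N : splittingFieldType rat) (k : {subfield N}) : galois k {:N}.
Proof.
apply/and3P; split; [exact: subvf| |exact: normalFieldf].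
by apply/separableP => x _; exact/pcharf0_separable/pchar0_fieldExt.
Qed.

Lemma mem_galois_fixed (N : splittingFieldType rat) (k : {subfield N}) (x : N) :
  (forall g, g \in 'Gal({:N} / k)%g -> g x = x) -> x \in k.
Proof.
move=> h; have /galois_fixedField <- := galois_rat k.
by apply/fixedFieldP; rewrite ?memvf.
Qed.

Definition gal_rmorphism (N : splittingFieldType rat) (g : gal_of {:N}) :
  {rmorphism N -> N} := g.

(* The value group of [w] on [k] is generated by [p]. *)
Definition unramified_at (R : realType) p (N : fieldExtType rat) (w : N -> R)
    (k : {vspace N}) : Prop :=
  forall x, x \in k -> x != 0 -> exists n : int, w x = p%:R ^ n.

Lemma gal_adjoin_eq_on (N : splittingFieldType rat) (k : {subfield N}) (a : N)
    (g h : gal_of {:N}) :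
    g \in 'Gal({:N} / k)%g -> h \in 'Gal({:N} / k)%g -> g a = h a ->
  {in <<k; a>>%VS, g =1 h}.
Proof.
move=> gG hG gha _ /Fadjoin_polyP[q kq ->].
by rewrite -!horner_map (fixedPoly_gal (subvf k) gG kq) (fixedPoly_gal (subvf k) hG kq) /= gha.
Qed.

Section UnramifiedCompositum.
Variables (R : realType) (p : nat) (N : splittingFieldType rat) (w : N -> R).
Hypotheses (pp : prime p) (hw : place_over (Some p) w).
Variables (F : fieldExtType rat) (s : 'I_(\dim {:F}) -> {rmorphism F -> N}).
Hypothesis hs : forall g : {rmorphism F -> N}, exists i, g =1 s i.
Variable b : 'I_(\dim {:F}) -> F.
Hypothesis wb : forall i j, w (s i (b j)) <= 1.
Hypothesis wdet : w (\det (embedding_mx s b)) = 1.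
Variable k : {subfield N}.
Hypothesis wk : unramified_at p w k.

Let M := embedding_mx s b.
Let uM : M \in unitmx.
Proof. by rewrite unitmxE unitfE -(absv_gt0 hw.1) wdet. Qed.

(* Replace [y] by an approximation [z] that is small at the conjugate places, and
   solve [sum_j s_i(b_j) c_j = z_i], where [z_i] is the conjugate of [z] attached to
   [s_i] or 0: by Galois invariance [c_j] is in [k], and since the matrix is
   integral and unimodular at [w], some [c_j] has the absolute value of [y]. *)
Lemma unramified_adjoin (t : F) (f : {rmorphism F -> N}) :
  <<1; t>>%VS = fullv -> unramified_at p w <<k; f t>>.
Proof.
move=> gen_t; set E := <<k; f t>>%AS => y yE y0.
have [i0 fi0] := hs f.
pose G := 'Gal({:N} / k)%g.
have wy0 : 0 < w y by rewrite (absv_gt0 hw.1).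
have [z [zE wzy hz]] : exists z, [/\ z \in E, w (z - y) < w y &
    forall g, g \in G -> w (g z) <= w y].
  pose v0 : subvs_of E -> R := w \o vsval.
  have hv0 : place_over (Some p) v0 := place_over_comp (vsval : {rmorphism _ -> _}) hw.
  pose vg (g : gal_of {:N}) : subvs_of E -> R := w \o (gal_rmorphism g \o vsval).
  have hvg g : place_over (Some p) (vg g).
    exact: (place_over_comp (gal_rmorphism g \o vsval : {rmorphism _ -> _})).
  have [v vs|//|z [z1 z2]] := weak_approximation (P := Some p) pp (Subvs yE)
      (s := [seq x <- [seq vg g | g <- enum G] | x != v0]) hv0 (e := w y).
    move: vs; rewrite mem_filter => /andP[/eqP vv0 /mapP[g _ vE]].
    by split=> //; rewrite vE.
  have e1 : w (vsval z - y) < w y by rewrite -[y]/(vsval (Subvs yE)) -rmorphB.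
  exists (vsval z); split=> [||g gG]; rewrite ?subvsP //.
  have [e|ne] := eqVneq (vg g) v0; last first.
    apply/ltW/(z2 (vg g)); rewrite mem_filter ne /=.
    by apply/mapP; exists g; rewrite ?mem_enum.
  have -> : w (g (vsval z)) = v0 z by rewrite -e.
  rewrite /v0 /= -[vsval z](subrK y); apply: (place_overD_nonarch pp hw) => //.
  exact: ltW.
have wzE : w z = w y.
  apply/le_anti/andP; split.
    rewrite -[z](subrK y); apply: (place_overD_nonarch pp hw) => //; exact: ltW.
  rewrite leNgt; apply/negP => h; have : w y < w y.
    rewrite -{1}[y](subKr z).
    apply: le_lt_trans (place_overD (P := Some p) _ _ pp hw) _.
    by rewrite mul1r gt_max h (absvN hw.1).
  by rewrite ltxx.
pose zi i : N := if [pick g in G | g (f t) == s i t] is Some g then g z else 0.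
pose Z : 'cV[N]_(\dim {:F}) := \col_i zi i.
pose c := invmx M *m Z.
have Mc : M *m c = Z by rewrite mulKVmx.
have ziE g i : g \in G -> g (f t) = s i t -> zi i = g z.
  move=> gG gt; rewrite /zi; case: pickP => [h /andP[hG /eqP ht]|/(_ g)]; last first.
    by rewrite gG gt eqxx.
  by apply: (gal_adjoin_eq_on (a := f t) hG gG); rewrite ?ht ?gt.
have ck j : c j 0 \in k.
  (* Applying [g] permutes the embeddings, hence the rows of [M], and permutes the entries of [Z]
     accordingly; so [c'] solves the same system as [c]. *)
  apply: mem_galois_fixed => g gG; pose c' := map_mx (gal_rmorphism g) c.
  suff cc' : c' = c by have := congr1 (fun X : 'cV[N]_(\dim {:F}) => X j 0) cc'; rewrite mxE.
  suff Mc' : M *m c' = Z by rewrite -[c'](mulKmx uM) Mc'.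
  apply/colP => i; rewrite mxE.
  have [i' hi'] := hs (gal_rmorphism (g^-1)%g \o s i).
  have gs x : g (s i' x) = s i x.
    by rewrite -hi' /= -galM ?memvf // mulVg gal_id.
  have -> : \sum_j0 M i j0 * c' j0 0 = gal_rmorphism g ((M *m c) i' 0).
    rewrite mxE rmorph_sum; apply: eq_bigr => j0 _.
    by rewrite !mxE rmorphM /= gs.
  rewrite Mc !mxE; rewrite {2}/zi; case: pickP => [h /andP[hG /eqP ht]|nh].
    have h' : (h * g^-1)%g (f t) = s i' t.
      by rewrite galM ?memvf // ht; exact: hi'.
    have hgG : (h * g^-1)%g \in G by rewrite /G groupM ?groupV.
    have -> : zi i' = (h * g^-1)%g z := ziE _ _ hgG h'.
    have -> : gal_rmorphism g ((h * g^-1)%g z) = (h * g^-1 * g)%g z.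
      by rewrite [RHS]galM ?memvf.
    by rewrite mulgKV.
  rewrite {1}/zi; case: pickP => [h /andP[hG /eqP ht]|_]; last exact: rmorph0.
  have := nh (h * g)%g; rewrite /G groupM // galM ?memvf // ht gs eqxx.
  by [].
have wc j : w (c j 0) <= w y.
  rewrite mxE; apply: (place_over_sum_nonarch pp hw) => [|i _].
    exact: absv_ge0 hw.1 _.
  rewrite (absvM hw.1) -[X in _ <= X]mul1r ler_pM ?(absv_ge0 hw.1) //.
    by apply: (place_over_invmx_le1 pp hw) => // i' j'; rewrite mxE.
  rewrite mxE /zi; case: pickP => [g /andP[gG _]|_]; first exact: hz.
  by rewrite (absv0 hw.1) (absv_ge0 hw.1).
(* Row [i0] belongs to [f] itself, and the identity of the Galois group makes its entry in [Z] equal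
   to [z]. *)
have zc : z = \sum_j M i0 j * c j 0.
  have : (M *m c) i0 0 = z.
    by rewrite Mc mxE (ziE 1%g) ?group1 ?gal_id // -fi0 .
  by rewrite mxE.
have z0 : z != 0 by rewrite -(absv_gt0 hw.1) wzE.
have [j hj] : exists j, w (\sum_j M i0 j * c j 0) <= w (M i0 j * c j 0).
  by apply: (place_over_sum_attained pp hw); rewrite -zc.
have wcj : w (c j 0) = w y.
  apply/le_anti; rewrite wc /= -wzE {1}zc (le_trans hj) // (absvM hw.1).
  by rewrite ler_piMl ?(absv_ge0 hw.1) // mxE.
by rewrite -wcj; apply: wk => //; rewrite -(absv_gt0 hw.1) wcj.
Qed.

End UnramifiedCompositum.

(** Only integrality over [p] is asked of [b]. The discriminant condition supplies such a family for
    the fields of the [alpha_j], and an arbitrary rational basis of [K] supplies one at all large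
    [p]. *)
Definition unramified_ext (R : realType) (p : nat) (F : fieldExtType rat) : Prop :=
  exists b : 'I_(\dim {:F}) -> F,
    (forall (v : F -> R) i, place_over (Some p) v -> v (b i) <= 1) /\
    padic_abs R p (\det (\matrix_(i, j) field_trace (b i * b j))) = 1.

Lemma algebraic_integer_le1 (R : realType) (F : fieldExtType rat) p (v : F -> R) x :
  prime p -> place_over (Some p) v -> algebraic_integer x -> v x <= 1.
Proof.
move=> pp pv [q mq qx].
apply: (place_over_le1_integral pp pv (q := map_poly intr q)).
- exact: monic_map.
- by move=> i; rewrite coef_map padic_abs_int_le1.
suff -> : map_poly (in_alg F) (map_poly intr q) = map_poly intr q by [].
rewrite -map_poly_comp; apply: eq_map_poly => a /=.
by rewrite -in_algE rmorph_int.
Qed.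

(* The default value 0 of [discriminant] is divisible by [p], so that the
   hypothesis also provides an integral basis. *)
Lemma unramified_ext_discriminant (R : realType) (p : nat) (F : fieldExtType rat) :
  prime p -> ~~ (p%:Z %| discriminant F)%Z -> unramified_ext R p F.
Proof.
rewrite /discriminant => pp; case: xgetP => [D -> [b [ib _] eD] pD|_]; last first.
  by rewrite dvdz0.
exists b; split=> [v i pv|]; first exact: algebraic_integer_le1 pp pv (ib i).
by rewrite -eD padic_abs_int_eq1.
Qed.

(** For large [p] a fixed basis is integral over [p], and the numerator and denominator of its
    discriminant are prime to [p]. The embeddings into [N] serve to see that this discriminant is
    nonzero. *)
Lemma unramified_ext_eventually (R : realType) (F : fieldExtType rat)
    (N : splittingFieldType rat) (f : {rmorphism F -> N}) :
  exists B, forall p, prime p -> (B < p)%N -> unramified_ext R p F.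
Proof.
have [s _ us] := embeddings_exist f.
pose e i : F := (vbasis {:F})`_i.
pose D := \det (\matrix_(i < \dim {:F}, j < \dim {:F}) field_trace (e i * e j)).
have D0 : D != 0.
  rewrite -(fmorph_eq0 (in_alg N)) /= (det_embedding_mx e us) expf_neq0 //.
  by rewrite -unitfE -unitmxE.
have /choice[B hB] (i : 'I_(\dim {:F})) := eventually_integral (e i).
exists (\sum_i B i + `|numq D| + `|denq D|)%N => p pp Bp; exists e; split=> [v i pv|].
  apply: (hB i R p v pp _ pv); apply: leq_ltn_trans Bp.
  by rewrite (bigD1 i) //= -!addnA leq_addr.
rewrite -/D /padic_abs (negPf D0) !logn_coprime ?expr0 ?divr1 //.
  rewrite prime_coprime // gtnNdvd ?absz_gt0 ?numq_eq0 //.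
  by apply: leq_ltn_trans Bp; rewrite addnAC leq_addl.
rewrite prime_coprime // gtnNdvd ?absz_gt0 ?denq_eq0 //.
by apply: leq_ltn_trans Bp; rewrite leq_addl.
Qed.

(** The Gram determinant is the square of the embedding determinant, which is therefore a unit at
    [w]. *)
Lemma unramified_at_adjoin (R : realType) (p : nat) (N : splittingFieldType rat)
    (w : N -> R) (F : fieldExtType rat) (f : {rmorphism F -> N}) (t : F)
    (k : {subfield N}) :
    prime p -> place_over (Some p) w -> unramified_ext R p F ->
    <<1; t>>%VS = fullv ->
  unramified_at p w k -> unramified_at p w <<k; f t>>.
Proof.
move=> pp hw [b [hb hD]] gen_t wk; have [s hs us] := embeddings_exist f.
have wb i j : w (s i (b j)) <= 1.
  by apply: (hb (w \o s i)); exact: place_over_comp.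
apply: (unramified_adjoin pp hw hs wb _ wk) => //.
have := det_embedding_mx b us => /(congr1 w); rewrite hw.2 /= hD (absvX hw.1).
move/esym/eqP; rewrite sqrp_eq1; first by move/eqP.
exact: absv_ge0 hw.1 _.
Qed.

Lemma unramified_at_rat (R : realType) (p : nat) (N : fieldExtType rat) (w : N -> R) :
  prime p -> place_over (Some p) w -> unramified_at p w 1%AS.
Proof.
move=> pp hw x /vlineP[a ->]; rewrite scaler_eq0 oner_eq0 orbF => a0.
rewrite hw.2 /= /padic_abs (negPf a0).
exists ((logn p `|denq a|)%:Z - (logn p `|numq a|)%:Z).
by rewrite expfzDr ?pnatr_eq0 -?lt0n ?prime_gt0 // -exprnN.
Qed.

(** * Eisenstein extensions *)

Section Eisenstein.
Variables (R : realType) (p : nat) (N : fieldExtType rat) (w : N -> R).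
Hypotheses (pp : prime p) (hw : place_over (Some p) w).
Let hv := hw.1.

Lemma place_over_sum_dominant n (f : 'I_n -> N) i :
  (forall j, j != i -> w (f j) < w (f i)) -> w (\sum_j f j) = w (f i).
Proof.
move=> h; have [wi|wi] := leP (w (f i)) 0.
  rewrite big1 ?(absv0 hv).
    by apply/esym/le_anti; rewrite wi (absv_ge0 hv).
  move=> j _; apply/eqP; rewrite -(absv_eq0 hv); apply/eqP/le_anti.
  rewrite (absv_ge0 hv) andbT; have [->//|/h/ltW/le_trans] := eqVneq j i.
  exact.
rewrite (bigD1 i) //=; set r := \sum_(j | _) _.
have wr : w r < w (f i).
  rewrite /r; elim/big_ind: _ => [|x y hx hy|j /h//]; first by rewrite (absv0 hv).
  apply: le_lt_trans (place_overD (P := Some p) _ _ pp hw) _.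
  by rewrite mul1r gt_max hx.
apply/le_anti/andP; split.
  by apply: (place_overD_nonarch pp hw) => //; exact: ltW.
rewrite leNgt; apply/negP => lt.
suff : w (f i) < w (f i) by rewrite ltxx.
rewrite -{1}[f i](addrK r) -[- r]opprK opprK.
apply: le_lt_trans (place_overD (P := Some p) _ _ pp hw) _.
by rewrite mul1r gt_max lt (absvN hv).
Qed.

Variables (D : {poly int}) (u : R).
Hypothesis hD : eisenstein p D.
Let d := (size D).-1.
Hypotheses (u0 : 0 < u) (ud : u ^+ d = p%:R^-1).

Let d0 : (0 < d)%N. Proof. by rewrite /d; case: hD; case: (size D) => [|[]]. Qed.

Let p1 : 1 < p%:R :> R. Proof. by rewrite ltr1n prime_gt1. Qed.

Let pi1 : p%:R^-1 < 1 :> R. Proof. by rewrite invf_lt1 // (lt_trans ltr01). Qed.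

Let pi0 : 0 < p%:R^-1 :> R. Proof. by rewrite invr_gt0 (lt_trans ltr01). Qed.

Let u1 : u < 1.
Proof. by rewrite -(@expr_lt1 _ d) ?(ltW u0) // ud. Qed.

(** The Newton polygon of [D] is a single segment of slope [1/d]. The statement is about any root
    and any place over [p], so it applies to all conjugates of a root. *)
Lemma eisenstein_root_abs a : root (map_poly intr D) a -> w a = u.
Proof.
move=> /rootP Da; have [mD sD pD pD0] := hD.
have sDd : size D = d.+1 by rewrite /d prednK // (ltn_trans _ sD).
have ad : a ^+ d = - \sum_(i < d) (D`_i)%:~R * a ^+ i.
  apply/eqP; rewrite -addr_eq0 addrC; apply/eqP; rewrite -{}[RHS]Da horner_coef.
  rewrite size_map_inj_poly ?sDd //; last first.
    by move=> i j /eqP; rewrite -!(rmorph_int (in_alg N)) (inj_eq (fmorph_inj _)) eqr_int => /eqP.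
  rewrite big_ord_recr /= coef_map /= -/(lead_coef D) (monicP mD) mul1r.
  by congr (_ + _); apply: eq_bigr => i _; rewrite coef_map.
have wint n : w n%:~R = padic_abs R p n%:~R.
  by rewrite -(rmorph_int (in_alg N)) /= hw.2.
have wDi i : (i < d)%N -> w (D`_i)%:~R <= p%:R^-1.
  by move=> id; rewrite wint padic_abs_dvd // pD.
have wD0 : w (D`_0)%:~R = p%:R^-1.
  apply/le_anti; rewrite wDi //= wint.
  have D0 : D`_0 != 0 by apply: contraNneq pD0 => ->; rewrite dvdz0.
  rewrite padic_abs_int // lef_pV2 ?posrE ?exprn_gt0 ?(lt_trans ltr01) //.
  rewrite -[X in _ <= X]expr1 ler_eXn2l // leqNgt; apply: contra pD0 => h.
  by rewrite dvdzE /= pfactor_dvdn // absz_gt0.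
have wa1 : w a < 1.
  rewrite ltNge; apply/negP => a1.
  have : w (a ^+ d) <= p%:R^-1 * w a ^+ d.
    rewrite {1}ad (absvN hv); apply: (place_over_sum_nonarch pp hw).
      by rewrite mulr_ge0 ?exprn_ge0 ?(absv_ge0 hv) // ltW.
    move=> i _; rewrite (absvM hv) (absvX hv) ler_pM ?exprn_ge0 ?(absv_ge0 hv) //.
      exact: wDi.
    by rewrite ler_weXn2l // ltnW.
  rewrite (absvX hv) leNgt; apply/negP; rewrite negbK gtr_pMl ?exprn_gt0 //.
  exact: lt_le_trans a1.
(* Once [w a < 1], the constant term strictly dominates the other lower terms. *)
have : w (a ^+ d) = p%:R^-1.
  have i0 : 'I_d := Ordinal d0.
  rewrite ad (absvN hv) (@place_over_sum_dominant d _ (Ordinal d0)) /= ?expr0 ?mulr1 //.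
  move=> j j0; rewrite (absvM hv) (absvX hv) wD0.
  have j1 : (0 < j)%N by rewrite lt0n; apply: contra j0 => /eqP e; apply/eqP/val_inj.
  apply: le_lt_trans (_ : p%:R^-1 * w a < _); last by rewrite gtr_pMr.
  rewrite ler_pM ?exprn_ge0 ?(absv_ge0 hv) ?wDi // -[X in _ <= X]expr1.
  by rewrite ler_wiXn2l ?(absv_ge0 hv) // ltW.
rewrite (absvX hv) -ud => /eqP; rewrite eqrXn2 ?(absv_ge0 hv) ?ltW //.
by move/eqP.
Qed.

Variable k : {subfield N}.
Hypothesis wk : unramified_at p w k.

Let wkE x : x \in k -> x != 0 -> exists n : int, w x = u ^ (d%:Z * n).
Proof.
move=> xk x0; have [n ->] := wk xk x0; exists (- n).
by rewrite -exprz_exp -exprnP ud -exprz_inv invrK.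
Qed.

(* The nonzero terms have absolute values [u ^ e] with [e] in distinct classes
   modulo [d]. *)
Lemma eisenstein_horner_abs a (q : {poly N}) : w a = u -> q \is a polyOver k ->
    (size q <= d)%N ->
  (forall j, (j < d)%N -> w (q`_j) * u ^+ j <= w q.[a]) /\
  exists2 j, (j < d)%N & w q.[a] <= w (q`_j) * u ^+ j.
Proof.
move=> wa kq sq; rewrite (horner_coef_wide a sq).
pose f (j : 'I_d) := q`_j * a ^+ j.
have wf j : w (f j) = w (q`_j) * u ^+ j by rewrite (absvM hv) (absvX hv) wa.
case: (@arg_maxP _ _ 'I_d (Ordinal d0) xpredT (fun j => w (f j))) => // i _ hi0.
have {hi0} hi j : w (f j) <= w (f i) by exact: hi0.
have [fi|fi] := eqVneq (w (f i)) 0.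
  have f0 j : f j = 0.
    apply/eqP; rewrite -(absv_eq0 hv); apply/eqP/le_anti.
    by rewrite (absv_ge0 hv) andbT -fi hi.
  rewrite -[\sum_i0 _]/(\sum_i0 f i0) big1 // (absv0 hv); split=> [j jd|].
    by rewrite -(wf (Ordinal jd)) f0 (absv0 hv).
  exists i => //; rewrite -wf; exact: absv_ge0 hv _.
have e : w (\sum_j f j) = w (f i).
  apply: place_over_sum_dominant => j ji; rewrite lt_def hi // andbT.
  apply: contra ji => /eqP e.
  have nz l : w (f l) != 0 -> q`_l != 0.
    by apply: contraNneq => q0; rewrite /f q0 mul0r (absv0 hv).
  have [ni eni] := wkE (polyOverP kq i) (nz i fi).
  have [nj enj] : exists n : int, w q`_j = u ^ (d%:Z * n).
    by apply: wkE (polyOverP kq j) (nz j _); rewrite -e.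
  have un0 : u != 0 by rewrite gt_eqF.
  move: e; rewrite !wf eni enj !exprnP -!expfzDr // => /eqP.
  have un1 : u != 1 by rewrite lt_eqF.
  rewrite (inj_eq (ieexprIz u0 un1)) => /eqP e.
  apply/eqP/val_inj => /=.
  have : (j%:Z = i %[mod d])%Z.
    have -> : j%:Z = (ni - nj) * d%:Z + i%:Z.
      have -> : (ni - nj) * d%:Z + i%:Z = d%:Z * ni + i%:Z - d%:Z * nj by ring.
      by rewrite e addrC addKr.
    by rewrite modzMDl.
  by rewrite !modz_nat !modn_small // => -[].
rewrite -[\sum_i0 _]/(\sum_i0 f i0) e; split=> [j jd|].
  by rewrite -(wf (Ordinal jd)) hi.
by exists i => //; rewrite wf.
Qed.

(** Both values of [q] have the same absolute value, the largest [w q_j * u ^+ j]. In the difference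
    the constant terms cancel, and each remaining nonzero term is bounded by some [u ^ e] with [d]
    not dividing [e], so [e] is nonzero. For [e >= 1] this is at most [u]; for [e <= -1] the maxima
    on the right compensate. *)
Lemma eisenstein_conjugates_close a a' (q : {poly N}) : w a = u -> w a' = u ->
    q \is a polyOver k -> (size q <= d)%N ->
  w (q.[a] - q.[a']) <= u * (Num.max 1 (w q.[a]) * Num.max 1 (w q.[a'])).
Proof.
move=> wa wa' kq sq.
have [h1 [i id h2]] := eisenstein_horner_abs wa kq sq.
have [h1' [i' id' h2']] := eisenstein_horner_abs wa' kq sq.
have <- : w q.[a] = w q.[a'].
  by apply/le_anti; rewrite (le_trans h2 (h1' _ id)) (le_trans h2' (h1 _ id')).
set B := w q.[a] in h1 *; set m := Num.max 1 B.
have m1 : 1 <= m by rewrite le_max lexx.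
have mB : B <= m by rewrite le_max lexx orbT.
have m0 : 0 < m by apply: lt_le_trans m1.
rewrite !(horner_coef_wide _ sq) -sumrB; apply: (place_over_sum_nonarch pp hw).
  by rewrite !mulr_ge0 // ltW.
move=> j _; rewrite -mulrBr (absvM hv).
have [q0|q0] := eqVneq q`_j 0.
  by rewrite q0 (absv0 hv) mul0r !mulr_ge0 // ltW.
have [j0|j0] := eqVneq (j : nat) 0%N.
  by rewrite j0 !expr0 subrr (absv0 hv) mulr0 !mulr_ge0 // ltW.
apply: (@le_trans _ _ (w q`_j * u ^+ j)).
  rewrite ler_wpM2l ?(absv_ge0 hv) //; apply: (place_overD_nonarch pp hw).
    by rewrite (absvX hv) wa.
  by rewrite (absvN hv) (absvX hv) wa'.
have hj := h1 j (ltn_ord j).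
have [n en] := wkE (polyOverP kq j) q0; rewrite en in hj *.
have un0 : u != 0 by rewrite gt_eqF.
move: hj; rewrite exprnP -expfzDr //; set e := _ + _ => hj.
have e0 : e != 0.
  apply/eqP => e0; have : (d %| j)%N.
    rewrite -[(d %| j)%N]/((d%:Z %| j%:Z)%Z); apply/dvdzP; exists (- n).
    by move/eqP: e0; rewrite /e addrC addr_eq0 => /eqP ->; rewrite mulNr mulrC.
  by rewrite gtnNdvd // lt0n.
have [e1|e1] : 1 <= e \/ e <= -1 by case: (e) e0 => [[|n']|n'] //; [left|right].
  apply: (@le_trans _ _ u); last first.
    by rewrite ler_pMr // (le_trans m1) // ler_pMr.
  rewrite -[X in _ <= X]expr1z; case: (e) e1 => // n' e1.
  by rewrite -!exprnP ler_wiXn2l // ltW.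
(* Here the value of [q] is at least [1/u], so one factor [m] absorbs [u] and the other bounds the
   term. *)
apply: (le_trans hj); apply: (le_trans mB).
rewrite mulrA ler_pMl // -ler_pdivrMl // mulr1 (le_trans _ mB) //.
apply: le_trans hj; case: (e) e1 => // n' _.
rewrite -[u ^ _]/((u ^+ n'.+1)^-1) -exprVn -[X in X <= _]expr1.
by rewrite ler_weXn2l // invf_ge1 // ltW.
Qed.

End Eisenstein.

(** * The product formula *)

Lemma prod_ege1 (R : realType) (I : Type) (r : seq I) (Q : pred I) (f : I -> R) :
  (forall i, Q i -> 1 <= f i) -> 1 <= \prod_(i <- r | Q i) f i.
Proof. by move=> h; elim/big_ind: _ => // x y; exact: mulr_ege1. Qed.

Lemma height_in_ge0 (R : realType) (F : fieldExtType rat) (x : F) : 0 <= height_in R x.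
Proof. by apply: prodr_ge0 => v _; exact: powR_ge0. Qed.

Definition primes_below (B : nat) : seq nat := [seq q <- iota 0 B | prime q].

Definition places_below (B : nat) : seq (option nat) :=
  None :: [seq Some q | q <- primes_below B].

Lemma mem_primes_below B q : (q \in primes_below B) = prime q && (q < B)%N.
Proof. by rewrite mem_filter mem_iota. Qed.

Lemma uniq_places_below B : uniq (places_below B).
Proof.
rewrite /= map_inj_uniq => [|x y [->]//]; rewrite filter_uniq ?iota_uniq // andbT.
by apply/negP => /mapP[].
Qed.

Lemma places_below_prime B P : P \in places_below B -> rat_place P.
Proof.
by rewrite inE => /orP[/eqP->//|/mapP[q]]; rewrite mem_primes_below => /andP[qq _] ->.
Qed.

Lemma mem_places_below B q : prime q -> (q < B)%N -> Some q \in places_below B.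
Proof.
move=> qq qB; rewrite inE orFb; apply/mapP; exists q => //.
by rewrite mem_primes_below qq.
Qed.

Lemma prod_primes_below n B : (0 < n)%N -> (n < B)%N ->
  (\prod_(q <- primes_below B) q ^ logn q n)%N = n.
Proof.
move=> n0 nB; rewrite big_filter big_mkcond /= -[in RHS](partnT n0) /partn.
have -> : iota 0 B = index_iota 0 B by rewrite /index_iota subn0.
rewrite (@big_cat_nat _ _ _ n.+1) //= [X in (_ * X)%N]big1_seq ?muln1.
  by apply: eq_bigr => q _; rewrite lognE; case: (prime q).
move=> q /andP[_]; rewrite mem_index_iota => /andP[nq _].
rewrite lognE n0 gtnNdvd //= andbF expn0.
by case: ifP.
Qed.

Lemma ratr_normE (R : realType) (a : rat) :
  ratr `|a| = `|numq a|%N%:R / `|denq a|%N%:R :> R.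
Proof.
rewrite -{1}(divq_num_den a) normrM normfV -!intr_norm -!abszE.
by rewrite fmorph_div /= !ratr_nat.
Qed.

(** The cut-off leaves out only primes that divide neither the numerator nor the denominator. *)
Lemma rat_product_formula (R : realType) (a : rat) B : a != 0 ->
    (`|numq a| < B)%N -> (`|denq a| < B)%N ->
  \prod_(P <- places_below B) rat_abs R P a = 1.
Proof.
move=> a0 nB dB; rewrite big_cons big_map /=.
have n0 : (0 < `|numq a|)%N by rewrite absz_gt0 numq_eq0.
have d0 : (0 < `|denq a|)%N by rewrite absz_gt0 denq_eq0.
under eq_bigr do rewrite /padic_abs (negPf a0).
rewrite prodf_div.
under eq_bigr do rewrite -natrX.
under [X in _ / X]eq_bigr do rewrite -natrX.
rewrite -!natr_prod !prod_primes_below //.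
by rewrite ratr_normE mulrA divfK ?divff // pnatr_eq0 -lt0n.
Qed.

Section NormInequality.
Variables (R : realType) (N : splittingFieldType rat) (w : option nat -> N -> R).
Hypothesis hw : forall P, rat_place P -> place_over P (w P).

Let G := 'Gal({:N} / 1)%g.

Lemma gal_prod_reindex (h : N -> R) (g : gal_of {:N}) y : g \in G ->
  \prod_(s in G) h (s (g y)) = \prod_(s in G) h (s y).
Proof.
move=> gG; rewrite [RHS](reindex_inj (mulgI g)) /=.
apply: eq_big => [s|s sG]; first by rewrite groupMl.
by rewrite galM ?memvf.
Qed.

(** The product over the whole Galois group, instead of the embeddings of a subfield, makes this
    invariant under [y] to [g y]. *)
Definition conj_height (B : nat) (y : N) : R :=
  \prod_(P <- places_below B) \prod_(s in G) Num.max 1 (w P (s y)).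

Lemma conj_height_ge1 B y : 1 <= conj_height B y.
Proof.
rewrite /conj_height; apply: prod_ege1 => P _; apply: prod_ege1 => s _.
by rewrite le_max lexx.
Qed.

(* Multiply the inequalities [height_ge_prod] for the families [w P \o g], [g] in
   [G]. *)
Lemma conj_height_le B (F : fieldExtType rat) (f : {rmorphism F -> N}) (x : F) :
  conj_height B (f x) <= height_in R x ^+ #|G|.
Proof.
have [s hs us] := embeddings_exist f; set d := \dim {:F} in s hs us.
have d0 : (0 < d)%N by rewrite adim_gt0.
have le1 g : g \in G -> \prod_(P <- places_below B) \prod_i Num.max 1 (w P (g (s i x)))
    <= height_in R x ^+ d.
  move=> gG; apply: (height_ge_prod (w := fun P => w P \o gal_rmorphism g)).
  - exact: uniq_places_below.
  - move=> P /places_below_prime hP; split=> //.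
    exact: place_over_comp (gal_rmorphism g) (hw hP).
  - exact: us.
have h0 := height_in_ge0 R x.
have c0 : 0 <= conj_height B (f x) := le_trans ler01 (conj_height_ge1 B (f x)).
(* Each [s i x] is a Galois conjugate of [f x], so all [d] embeddings give the same product over
   [G]. *)
have e i : \prod_(P <- places_below B) \prod_(g in G) Num.max 1 (w P (g (s i x)))
    = conj_height B (f x).
  have [t gen_t] := primitive_element_rat F.
  have [q [_ eq _]] := rat_minPolyP t.
  have rt : root (minPoly 1 (f t)) (s i t).
    by rewrite (minPoly_rmorph f eq) -(minPoly_rmorph (s i) eq) root_minPoly.
  have [g gG gt] := normalField_root_minPoly (subvf _) (normalFieldf 1%AS) (memvf _) rt.
  have sx : s i x = g (f x).
    by have /(_ x) <- := rmorphism_eq_gen (f := gal_rmorphism g \o f) gen_t gt.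
  by apply: eq_bigr => P _; rewrite sx (gal_prod_reindex (fun y => Num.max 1 (w P y))).
(* The [d]-th power of the left side is a product over embeddings and group elements; exchanging the
   two turns it into [#|G|] products of the form bounded by [le1]. *)
rewrite -(@ler_pXn2r _ d) ?nnegrE ?exprn_ge0 // -exprM mulnC exprM.
have <- : \prod_(i < d) \prod_(P <- places_below B) \prod_(g in G)
    Num.max 1 (w P (g (s i x))) = conj_height B (f x) ^+ d.
  by under eq_bigr do rewrite e; rewrite prodr_const card_ord.
rewrite exchange_big /=; under eq_bigr do rewrite exchange_big /=.
rewrite exchange_big /= -prodr_const; apply: ler_prod => g gG; rewrite le1 // andbT.
apply: prodr_ge0 => P _; apply: prodr_ge0 => i _.
by rewrite le_max ler01.
Qed.

(** The norm [r] of [z] is a nonzero rational, so its absolute values multiply to 1. Each factor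
    [w P (s z)] costs the constant [c P]: 2 at the archimedean place, [u] at [p], 1 elsewhere. The
    closeness is assumed at all places over [p] because [w (Some p) \o s] varies with [s]. *)
Lemma conjugates_close_height p (u : R) (F : fieldExtType rat)
    (f : {rmorphism F -> N}) (x : F) (g : gal_of {:N}) :
    prime p -> 0 < u -> g \in G -> g (f x) != f x ->
    (forall v : N -> R, place_over (Some p) v ->
      v (f x - g (f x)) <= u * (Num.max 1 (v (f x)) * Num.max 1 (v (g (f x))))) ->
  1 <= 2 * u * height_in R x ^+ 2.
Proof.
move=> pp u0 gG gx hclose; set y := f x in gx hclose.
pose z := y - g y.
have z0 : z != 0 by rewrite subr_eq0 eq_sym.
pose r := \prod_(s in G) s z.
have [a ra] : exists a : rat, r = a%:A.
  apply/vlineP; apply: mem_galois_fixed => h hG.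
  rewrite -[h r]/(gal_rmorphism h r) rmorph_prod [RHS](reindex_inj (mulIg h)) /=.
  apply: eq_big => [s|s sG]; first by rewrite groupMr.
  by rewrite galM ?memvf.
have a0 : a != 0.
  have : r != 0.
    apply/prodf_neq0 => s _; rewrite -[s z]/(gal_rmorphism s z).
    by rewrite fmorph_eq0.
  by apply: contraNneq => a0; rewrite ra a0 scale0r.
(* Large enough for the product formula of [a], and for [p] to be among the primes below [B]. *)
pose B := (`|numq a| + `|denq a| + p).+1%N.
pose c P : R := add_const R P * (if P == Some p then u else 1).
have c0 P : 0 < c P.
  rewrite mulr_gt0 //; first by rewrite (lt_le_trans ltr01) ?add_const_ge1.
  by case: ifP.
have wz P s : P \in places_below B -> s \in G ->
    w P (s z) <= c P * (Num.max 1 (w P (s y)) * Num.max 1 (w P (s (g y)))).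
  move=> /places_below_prime hP sG; have hwP := hw hP; rewrite /c.
  have hs := place_over_comp (gal_rmorphism s) hwP.
  case: (eqVneq P (Some p)) => [Pp|_].
    rewrite Pp in hs *; rewrite mul1r.
    exact: hclose hs.
  rewrite mulr1; have := place_overD y (- g y) hP hs.
  rewrite (absvN hs.1) => /le_trans; apply.
  apply: ler_wpM2l; first exact: le_trans ler01 (add_const_ge1 _ _).
  have hm (b1 b2 : R) : Num.max b1 b2 <= Num.max 1 b1 * Num.max 1 b2.
    rewrite ge_max; apply/andP; split.
      by rewrite (@le_trans _ _ (Num.max 1 b1)) ?le_max ?lexx ?orbT // ler_peMr
        ?le_max ?ler01 ?lexx.
    by rewrite (@le_trans _ _ (Num.max 1 b2)) ?le_max ?lexx ?orbT // ler_peMl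
        ?le_max ?ler01 ?lexx.
  exact: hm.
have prod_c : \prod_(P <- places_below B) c P = 2 * u.
  have pB : Some p \in places_below B by rewrite mem_places_below // ltnS leq_addl.
  rewrite /c big_split /=; congr (_ * _).
    rewrite /places_below big_cons big_map big1 ?mulr1 //.
  rewrite (bigD1_seq (Some p)) ?uniq_places_below //= eqxx big1 ?mulr1 //.
  by move=> P /negPf ->.
have h0 := height_in_ge0 R x.
have hle : conj_height B y <= height_in R x ^+ #|G| := conj_height_le B f x.
have hge : 1 <= (2 * u) ^+ #|G| * (conj_height B y * conj_height B y).
  have prod_a : \prod_(P <- places_below B) rat_abs R P a = 1.
    by rewrite rat_product_formula // ltnS -!addnA ?leq_addr // addnCA leq_addr.
  rewrite -[X in X <= _]prod_a -prod_c -prodrXl {2}/conj_height.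
  have -> : \prod_(P <- places_below B) \prod_(s in G) Num.max 1 (w P (s y)) =
     \prod_(P <- places_below B) \prod_(s in G) Num.max 1 (w P (s (g y))).
    apply: eq_bigr => P _.
    by rewrite (gal_prod_reindex (fun y => Num.max 1 (w P y))).
  rewrite -!big_split /= !big_seq; apply: ler_prod => P PB.
  have hwP := hw (places_below_prime PB).
  rewrite -hwP.2 -ra (absv_ge0 hwP.1) /= (absv_prod hwP.1) -prodr_const -!big_split /=.
  apply: ler_prod => s sG; rewrite (absv_ge0 hwP.1) /=.
  exact: wz.
have G0 : (0 < #|G|)%N by apply/card_gt0P; exists 1%g; exact: group1.
rewrite -(@expr_ge1 _ #|G|) //; last first.
  by rewrite mulr_ge0 ?exprn_ge0 // mulr_ge0 // ltW.
apply: (le_trans hge); rewrite [X in _ <= X]exprMn -exprM mulnC exprM [X in _ <= _ * X]expr2.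
apply: ler_wpM2l; first by rewrite exprn_ge0 // mulr_ge0 // ltW.
have c1 : 0 <= conj_height B y := le_trans ler01 (conj_height_ge1 B y).
by rewrite ler_pM.
Qed.

End NormInequality.

(** * Northcott's theorem *)

Local Notation pQtoC := (map_poly (@ratr algC)).

Lemma splitting_field_exists (s : seq algC) :
  exists (N : splittingFieldType rat) (j : {rmorphism N -> algC}),
    forall a, a \in s -> exists x, j x = a.
Proof.
have /choice[m hm] (a : algC) : exists q : {poly rat}, q \is monic /\ root (pQtoC q) a.
  by have [q [_ mq] hq] := minCpolyP a; exists q; rewrite hq dvdpp.
pose Q := \prod_(a <- s) m a.
have mQ : Q \is monic by apply: monic_prod => a _; case: (hm a).
have [r Dr] := closed_field_poly_normal (pQtoC Q : {poly algC}).
rewrite lead_coef_map (monicP mQ) rmorph1 scale1r in Dr.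
have [L [j [rr Drr genL]]] := num_field_exists r.
have QL : map_poly (in_alg L) Q = \prod_(x <- rr) ('X - x%:P).
  have e1 : map_poly j (map_poly (in_alg L) Q) = pQtoC Q.
    by rewrite -map_poly_comp; apply: eq_map_poly => a /=; rewrite alg_num_field fmorph_rat.
  apply: (map_poly_inj j); rewrite [LHS]e1 [RHS]rmorph_prod /= Dr -Drr big_map; apply: eq_bigr => x _.
  by rewrite rmorphB /= map_polyX map_polyC.
have splitL : SplittingField.axiom L.
  exists (map_poly (in_alg L) Q); first exact: (alg_polyOver 1%AS).
  by exists rr; rewrite ?QL ?eqpxx.
pose LM := FieldExt_isSplittingField.Build _ L splitL.
pose N : splittingFieldType rat := HB.pack (FieldExt.sort L) LM.
exists N, j => a sa.
have : a \in r.
  rewrite -root_prod_XsubC -Dr /Q (big_rem a sa) /= rmorphM rootM.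
  by case: (hm a) => _ ->.
by rewrite -Drr => /mapP[x _ ->]; exists x.
Qed.

(** Heights live in [Qadj a] and the Galois argument in [N]; this compares the two inside [algC]. *)
Lemma rmorphism_lift (F : fieldExtType rat) (N : fieldExtType rat)
    (i : {rmorphism F -> algC}) (j : {rmorphism N -> algC}) (t : F) (z : N) :
  <<1; t>>%VS = fullv -> j z = i t ->
  exists f : {rmorphism F -> N}, f t = z /\ forall x, j (f x) = i x.
Proof.
move=> gen_t zt; have [q [_ eq _]] := rat_minPolyP t.
have [|f ft] := rmorphism_of_root (g := in_alg N) (z := z) gen_t eq.
  rewrite -(fmorph_root j) zt.
  have -> : map_poly j (map_poly (in_alg N) q) = map_poly i (map_poly (in_alg F) q).
    rewrite -!map_poly_comp; apply: eq_map_poly => a /=.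
    by rewrite !alg_num_field !fmorph_rat.
  by rewrite fmorph_root -eq root_minPoly.
exists f; split=> // x.
by apply: (rmorphism_eq_gen (f := j \o f) (g := i) gen_t); rewrite /= ft.
Qed.

(** Each linear factor costs one addition of two terms, hence one factor [add_const]. *)
Lemma absv_coef_prod_XsubC (R : realType) (F : fieldExtType rat) P (v : F -> R)
    (rs : seq F) k : rat_place P -> place_over P v ->
  v (\prod_(r <- rs) ('X - r%:P))`_k
    <= add_const R P ^+ size rs * \prod_(r <- rs) Num.max 1 (v r).
Proof.
move=> hP pv; have hv := pv.1; have C1 := add_const_ge1 R P.
have C0 : 0 <= add_const R P := le_trans ler01 C1.
elim: rs k => [|r rs IH] k.
  rewrite !big_nil expr0 mulr1 coef1.
  by case: (k == 0%N); rewrite ?(absv1 hv) ?(absv0 hv).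
rewrite !big_cons /= exprS.
set q := \prod_(r <- rs) _ in IH *.
set B := \prod_(r <- rs) _ in IH *.
set C := add_const R P ^+ _ in IH *.
have m1 : 1 <= Num.max 1 (v r) by rewrite le_max lexx.
have BC0 : 0 <= C * B.
  rewrite mulr_ge0 ?exprn_ge0 //; apply: prodr_ge0 => i _.
  by rewrite le_max ler01.
rewrite mulrBl coefB coefXM coefCM.
apply: le_trans (place_overD _ _ hP pv) _.
rewrite mulrACA -mulrA ler_wpM2l // (absvN hv) (absvM hv).
rewrite ge_max; apply/andP; split.
  apply: (@le_trans _ _ (C * B)); last by rewrite ler_peMl.
  by case: (k == 0%N); rewrite ?(absv0 hv).
by rewrite ler_pM ?(absv_ge0 hv) // le_max lexx orbT.
Qed.

Lemma denq_le_prod (R : realType) (c : rat) B : (`|denq c| < B)%N ->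
  (`|denq c|%N)%:R <= \prod_(q <- primes_below B) Num.max 1 (padic_abs R q c).
Proof.
move=> dB; have d0 : (0 < `|denq c|)%N by rewrite absz_gt0 denq_eq0.
rewrite -[X in X%:R <= _](prod_primes_below d0 dB) natr_prod !big_seq.
apply: ler_prod => q; rewrite mem_primes_below => /andP[qq _].
rewrite ler0n /= natrX; have [qd|qd] := boolP (q %| `|denq c|)%N; last first.
  by rewrite logn_coprime ?prime_coprime // expr0 le_max lexx.
have c0 : c != 0.
  by apply: contraTneq qd => ->; rewrite /= dvdn1 gtn_eqF // prime_gt1.
have qn : logn q `|numq c| = 0%N.
  by apply: logn_coprime; rewrite prime_coprime // dvdn_denq_numq.
by rewrite /padic_abs (negPf c0) qn expr0 divr1 le_max lexx orbT.
Qed.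

(** The coefficients are symmetric functions of the conjugates. The finite places bound the
    denominator by the height; the archimedean place then bounds the numerator, with the factor 2
    for each conjugate. *)
Lemma minPoly_coef_bound (R : realType) (F : fieldExtType rat)
    (N : splittingFieldType rat) (f : {rmorphism F -> N}) (x : F) (q : {poly rat}) k :
    <<1; x>>%VS = fullv -> minPoly 1 x = map_poly (in_alg F) q ->
  let M : R := (2 * height_in R x) ^+ \dim {:F} in
  `|numq q`_k|%N%:R <= M /\ `|denq q`_k|%N%:R <= M.
Proof.
move=> gen_x qx M.
have [s hs us] := embeddings_exist f.
have [w hw] := place_choice R N.
pose rs := [seq s i x | i <- enum 'I_(\dim {:F})].
have srs : size rs = \dim {:F} by rewrite size_map size_enum_ord.
have szq : size q = (\dim {:F}).+1.
  have := size_minPoly 1%AS x; rewrite qx size_map_poly => ->; congr _.+1.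
  by rewrite -gen_x dim_Fadjoin dimv1 muln1.
have mq : q \is monic by rewrite -(map_monic (in_alg F)) -qx monic_minPoly.
have urs : uniq rs.
  rewrite map_inj_in_uniq ?enum_uniq // => i j _ _ sij; apply/eqP.
  apply: contraTT us => ij; rewrite unitmxE unitfE negbK; apply/eqP.
  apply: (determinant_alternate ij) => l; rewrite !mxE.
  exact: rmorphism_eq_gen gen_x sij _.
have qE : map_poly (in_alg N) q = \prod_(r <- rs) ('X - r%:P).
  rewrite [LHS](@all_roots_prod_XsubC _ _ rs) ?uniq_rootsE //.
  - by rewrite lead_coef_map (monicP mq) rmorph1 scale1r.
  - by rewrite size_map_poly szq srs.
  apply/allP => _ /mapP[i _ ->].
  by rewrite -(minPoly_rmorph (s i) qx) root_minPoly.
set c := q`_k.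
pose h P := \prod_i Num.max 1 (w P (s i x)).
have h1 P : 1 <= h P by apply: prod_ege1 => i _; rewrite le_max lexx.
have hc P : rat_place P -> rat_abs R P c <= add_const R P ^+ \dim {:F} * h P.
  move=> hP; have pw := hw P hP; rewrite -pw.2 -in_algE -coef_map qE.
  apply: le_trans (absv_coef_prod_XsubC _ _ hP pw) _.
  by rewrite srs /rs big_map big_enum.
pose B := (`|denq c|).+1.
have hB : \prod_(P <- places_below B) h P <= height_in R x ^+ \dim {:F}.
  apply: height_ge_prod us; first exact: uniq_places_below.
  by move=> P /places_below_prime hP; split=> //; exact: hw.
rewrite big_cons big_map in hB.
have hden : `|denq c|%N%:R <= \prod_(j <- primes_below B) h (Some j).
  apply: le_trans (denq_le_prod R (ltnSn _)) _; rewrite !big_seq.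
  apply: ler_prod => j; rewrite mem_primes_below => /andP[jj _].
  rewrite le_max ler01 /= ge_max h1 /=.
  by have := hc (Some j) jj; rewrite expr1n mul1r.
have hd0 : 0 <= \prod_(j <- primes_below B) h (Some j) by apply: le_trans hden.
have H0 := height_in_ge0 R x.
split; last first.
  apply: (le_trans hden); apply: (@le_trans _ _ (height_in R x ^+ \dim {:F})).
    by apply: le_trans hB; rewrite ler_peMl.
  by rewrite /M exprMn ler_peMl ?exprn_ge0 // exprn_ege1 // ler1n.
(* The numerator is the archimedean absolute value times the denominator, so the two bounds involve
   disjoint sets of places and multiply to one height. *)
have : `|numq c|%N%:R = rat_abs R None c * `|denq c|%N%:R.
  have d0 : `|denq c|%N%:R != 0 :> R by rewrite pnatr_eq0 absz_eq0 denq_eq0.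
  by rewrite /= ratr_normE divfK.
move=> ->; rewrite /M exprMn.
apply: (@le_trans _ _ (2 ^+ \dim {:F} * h None * \prod_(j <- primes_below B) h (Some j))).
  apply: ler_pM => //; last exact: (hc None).
  by rewrite /= ler0q normr_ge0.
by rewrite -mulrA ler_wpM2l // exprn_ge0.
Qed.

Lemma finite_roots_bounded_coefs n M : finite_set [set a : algC | exists q : {poly rat},
  [/\ q != 0, root (pQtoC q) a, (size q <= n)%N &
      forall k, (`|numq q`_k| <= M)%N /\ (`|denq q`_k| <= M)%N]].
Proof.
(* A coefficient is encoded by numerator, denominator and sign; codes with denominator 0 merely add
   spurious polynomials. *)
pose I : finType := ('I_M.+1 * 'I_M.+1 * bool)%type.
pose c (u : I) : rat := (-1) ^+ u.2 * (u.1.1%:R / u.1.2%:R).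
pose Q (g : {ffun 'I_n -> I}) : {poly rat} :=
  \sum_(k < n) c (g k) *: 'X^k.
apply: (@sub_finite_set _ _ (\bigcup_(g in [set g | Q g != 0])
    [set a | root (pQtoC (Q g)) a])).
  move=> a [q [q0 qa sq hq]].
  have /choice[g hg] (k : 'I_n) : exists u : I, c u = q`_k.
    have [hn hd] := hq k.
    exists (inord `|numq q`_k|, inord `|denq q`_k|, (numq q`_k < 0)%R).
    rewrite /c /= !inordK ?ltnS //.
    rewrite -[RHS]divq_num_den mulrA; congr (_ / _).
      have := congr1 (intr : int -> rat) (intEsign (numq q`_k)).
      by rewrite rmorphM rmorph_sign => ->.
    by rewrite -[in RHS]absz_denq.
  have e : Q [ffun k => g k] = q.
    rewrite -[RHS]coefK; apply/polyP => k; rewrite coef_sum coef_poly.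
    under eq_bigr do rewrite ffunE hg coefZ coefXn.
    have [kn|kn] := ltnP k n.
      rewrite (bigD1 (Ordinal kn)) //= eqxx mulr1 big1 ?addr0.
        by case: ltnP => // ?; rewrite nth_default.
      by move=> i ik; rewrite eq_sym [_ == _](negPf ik) mulr0.
    rewrite big1 ?ltnNge ?(leq_trans sq kn) // => i _.
    by rewrite gtn_eqF ?mulr0 // (leq_trans (ltn_ord i)).
  by exists [ffun k => g k]; rewrite /= e.
apply: bigcup_finite => [|g /= Qg].
  exact: finite_finset.
have [r Dr] := closed_field_poly_normal (pQtoC (Q g) : {poly algC}).
apply: (@sub_finite_set _ _ [set` r]); last exact: finite_seq.
move=> a /=; rewrite Dr rootZ ?root_prod_XsubC //.
by rewrite lead_coef_eq0 map_poly_eq0.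
Qed.

(** Northcott's theorem: bounded degree and height leave finitely many minimal polynomials. *)
Lemma finite_bounded_degree_height (R : realType) (n : nat) (X : R) :
  finite_set [set a : algC | (\dim {:Qadj a} <= n)%N /\ weil_height R a <= X].
Proof.
(* The maximum with 1 makes the power increase with the exponent, as the degree is only bounded by
   [n]. *)
pose M := Num.bound ((2 * Num.max 1 X) ^+ n).
apply: sub_finite_set (finite_roots_bounded_coefs n.+1 M) => a [dn hX].
have [i ia gen_a] := Qadj_spec a.
have [N [j hj]] := splitting_field_exists [:: a].
have [z za] := hj a (mem_head _ _).
have [|f _] := rmorphism_lift (j := j) (i := i) (z := z) gen_a; first by rewrite za ia.
have [q [mq eq hq]] := rat_minPolyP (Qadj_gen a).
exists q; split.
- exact: monic_neq0.
- have -> : pQtoC q = map_poly i (map_poly (in_alg _) q).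
    by rewrite -map_poly_comp; apply: eq_map_poly => b /=; rewrite alg_num_field fmorph_rat.
  by rewrite -[X in root _ X]ia fmorph_root -eq root_minPoly.
- have := size_minPoly 1%AS (Qadj_gen a); rewrite eq size_map_poly => ->; rewrite ltnS.
  by apply: leq_trans dn; rewrite -gen_a dim_Fadjoin dimv1 muln1.
move=> k; have [h1 h2] := @minPoly_coef_bound R _ N f _ q k gen_a eq.
have H0 := height_in_ge0 R (Qadj_gen a).
have m1 : 1 <= Num.max 1 X by rewrite le_max lexx.
have hM : (2 * height_in R (Qadj_gen a)) ^+ \dim {:Qadj a} <= M%:R.
  apply: (@le_trans _ _ ((2 * Num.max 1 X) ^+ n)); last first.
    by apply/ltW/archi_boundP; rewrite exprn_ge0 // mulr_ge0 // (le_trans ler01).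
  apply: (@le_trans _ _ ((2 * Num.max 1 X) ^+ \dim {:Qadj a})).
    by rewrite lerXn2r ?nnegrE ?mulr_ge0 ?(le_trans ler01 m1) // ler_wpM2l // le_max hX orbT.
  by rewrite ler_weXn2l // mulr_ege1 // ler1n.
by rewrite -!(ler_nat R) !(le_trans _ hM).
Qed.

(** * The tower *)

Lemma dim_Fadjoin_rmorph (F N : fieldExtType rat) (f : {rmorphism F -> N}) (t : F) :
  <<1; t>>%VS = fullv -> \dim <<1; f t>> = \dim {:F}.
Proof.
move=> gen_t; have [q [_ eq _]] := rat_minPolyP t.
rewrite -[in RHS]gen_t !dim_Fadjoin !dimv1 !muln1; apply/succn_inj.
have := size_minPoly 1%AS (f t); rewrite (minPoly_rmorph f eq) => <-.
have := size_minPoly 1%AS t; rewrite eq => <-.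
by rewrite !size_map_poly.
Qed.

Lemma eisenstein_size_gt1 p (D : {poly int}) : eisenstein p D -> (1 < size D)%N.
Proof. by case. Qed.

Section Chain.
Variables (N : fieldExtType rat) (z : N) (za : nat -> N).

Fixpoint adjoin_chain (i : nat) : {subfield N} :=
  if i is i'.+1 then <<adjoin_chain i'; za i'>>%AS else <<1; z>>%AS.

Lemma adjoin_chain_leq i m : (i <= m)%N -> (adjoin_chain i <= adjoin_chain m)%VS.
Proof.
elim: m => [|m IH]; first by rewrite leqn0 => /eqP->.
rewrite leq_eqVlt => /orP[/eqP->//|]; rewrite ltnS => /IH /subv_trans; apply.
exact: subv_adjoin.
Qed.

Lemma adjoin_chain_gen i m : (i < m)%N -> za i \in adjoin_chain m.
Proof. by move/adjoin_chain_leq/subvP; apply; exact: memv_adjoin. Qed.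

End Chain.

Lemma adjoin_degree_root (N : fieldExtType rat) (k : {subfield N}) (a : N)
    (D : {poly int}) : D \is monic -> root (map_poly intr D) a ->
  (adjoin_degree k a <= (size D).-1)%N.
Proof.
move=> mD Da; rewrite -ltnS prednK ?lt0n ?size_poly_eq0 ?monic_neq0 //.
rewrite -size_minPoly; apply: leq_trans (size_poly _ _ : (size (map_poly intr D : {poly N}) <= _)%N).
apply: dvdp_leq; first by apply: monic_neq0; exact: monic_map.
apply: minPoly_dvdp => //; apply/polyOverP => i.
by rewrite coef_map /= -(rmorph_int (in_alg N)) /= rpredZ // rpred1.
Qed.

Lemma dim_adjoin_chain (N : fieldExtType rat) (z : N) (za : nat -> N)
    (D : nat -> {poly int}) i :
    (forall l, (l < i)%N -> D l \is monic /\ root (map_poly intr (D l)) (za l)) ->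
  (\dim (adjoin_chain z za i) <= \dim <<1; z>> * \prod_(l < i) (size (D l)).-1)%N.
Proof.
elim: i => [|i IH] h; first by rewrite big_ord0 muln1.
rewrite big_ord_recr /= mulnA dim_Fadjoin mulnC.
have [mD Da] := h i (ltnSn i).
rewrite leq_mul ?adjoin_degree_root // IH // => l li.
by apply: h; rewrite ltnS ltnW.
Qed.

Lemma is_subfield_generated (S : set algC) : is_subfield (generated_field S).
Proof.
split=> [B [[B1 _ _ _] _]//|x y hx hy B hB|x y hx hy B hB|x hx B hB].
- by case: (hB) => -[_ h _ _] _; apply: h; [exact: hx|exact: hy].
- by case: (hB) => -[_ _ h _] _; apply: h; [exact: hx|exact: hy].
- by case: (hB) => -[_ _ _ h] _; apply: h; exact: hx.
Qed.

Lemma generated_field_sub (S A : set algC) : is_subfield A -> S `<=` A ->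
  generated_field S `<=` A.
Proof. by move=> hA SA x; apply; split. Qed.

(** The stages increase, so their union is a subfield. Starting at [i0] ensures that the descent to
    stage [i0] makes sense. *)
Lemma generated_field_stage (S : set algC) (alpha : nat -> algC) a i0 :
  generated_field (S `|` range alpha) a ->
  exists m, (i0 <= m)%N /\ generated_field (S `|` [set alpha i | i in `I_m]) a.
Proof.
pose L m := generated_field (S `|` [set alpha i | i in `I_m]).
have Lsub m m' : (m <= m')%N -> L m `<=` L m'.
  move=> mm'; apply: generated_field_sub; first exact: is_subfield_generated.
  move=> x [Sx|[i /= im <-]] B [_ hB]; apply: hB; first by left.
  by right; exists i => //=; exact: leq_trans mm'.
pose U := [set x | exists2 m, (i0 <= m)%N & L m x].
have hU : is_subfield U.
  have L1 := fun m => is_subfield_generated (S `|` [set alpha i | i in `I_m]).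
  split=> [|x y [m im mx] [l il lx]|x y [m im mx] [l il lx]|x [m im mx]].
  - by exists i0 => //; case: (L1 i0).
  - exists (maxn m l); rewrite ?leq_max ?im //.
    case: (L1 (maxn m l)) => _ h _ _; apply: h.
      exact: Lsub (leq_maxl _ _) _ mx.
    exact: Lsub (leq_maxr _ _) _ lx.
  - exists (maxn m l); rewrite ?leq_max ?im //.
    case: (L1 (maxn m l)) => _ _ h _; apply: h.
      exact: Lsub (leq_maxl _ _) _ mx.
    exact: Lsub (leq_maxr _ _) _ lx.
  - by exists m => //; case: (L1 m) => _ _ _; apply.
move=> /(_ U)[|m im ma]; last by exists m.
split=> // x [Sx|[i _ <-]].
  by exists i0 => // B [_ hB]; apply: hB; left.
exists (maxn i0 i.+1); rewrite ?leq_maxl // => B [_ hB]; apply: hB; right.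
by exists i => //=; rewrite leq_maxr.
Qed.

Lemma adjoin_chain_generated (K N : fieldExtType rat) (iota : {rmorphism K -> algC})
    (j : {rmorphism N -> algC}) (t : K) (z : N) (za : nat -> N) (alpha : nat -> algC) m :
    <<1; t>>%VS = fullv -> j z = iota t ->
    (forall i, (i < m)%N -> j (za i) = alpha i) ->
  generated_field (range iota `|` [set alpha i | i in `I_m])
    `<=` [set j y | y in [set y | y \in adjoin_chain z za m]].
Proof.
move=> gen_t zt hza; apply: generated_field_sub.
  split=> [|_ _ [x /= xk <-] [y /= yk <-]|_ _ [x /= xk <-] [y /= yk <-]|_ [x /= xk <-]].
  - by exists 1; rewrite /= ?rpred1 ?rmorph1.
  - by exists (x - y); rewrite /= ?rpredB ?rmorphB.
  - by exists (x * y); rewrite /= ?rpredM ?rmorphM.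
  - by exists x^-1; rewrite /= ?rpredV ?fmorphV.
move=> _ [[x _ <-]|[i /= im <-]].
  have [f [ft jf]] := rmorphism_lift gen_t zt.
  exists (f x) => //=; apply: (subvP (adjoin_chain_leq z za (leq0n m))) => /=.
  have : x \in <<1; t>>%VS by rewrite gen_t memvf.
  case/Fadjoin1_polyP => q ->; rewrite -horner_map /= map_in_alg ft.
  by apply/Fadjoin1_polyP; exists q.
by exists (za i); [exact: adjoin_chain_gen|exact: hza].
Qed.

Section Tower.
Variables (R : realType) (K : fieldExtType rat) (iota : {rmorphism K -> algC}).
Variables (p : nat -> nat) (D : nat -> {poly int}) (alpha : nat -> algC).
Hypothesis p_prime : forall i, prime (p i).
Hypothesis D_eisenstein : forall i, eisenstein (p i) (D i).
Hypothesis alpha_root : forall i, root (map_poly intr (D i)) (alpha i).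
Hypothesis p_ndvd_disc : forall i j, (j < i)%N ->
  ~~ ((p i)%:Z %| discriminant (Qadj (alpha j)))%Z.

Variables (N : splittingFieldType rat) (j : {rmorphism N -> algC}).
Variables (t : K) (z : N) (za : nat -> N) (m : nat).
Hypothesis gen_t : <<1; t>>%VS = fullv.
Hypothesis zt : j z = iota t.
Hypothesis hza : forall i, (i < m)%N -> j (za i) = alpha i.

Lemma za_root i : (i < m)%N -> root (map_poly intr (D i)) (za i).
Proof.
move=> im; rewrite -(fmorph_root j) -map_poly_comp hza //.
rewrite (_ : map_poly _ (D i) = map_poly intr (D i)) ?alpha_root //.
by apply: eq_map_poly => a /=; rewrite rmorph_int.
Qed.

Lemma unramified_at_chain i l (w : N -> R) : unramified_ext R (p i) K ->
    place_over (Some (p i)) w -> (l <= i)%N -> (i < m)%N ->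
  unramified_at (p i) w (adjoin_chain z za l).
Proof.
move=> hK hw; elim: l => [|l IH] li im.
  have [f [<- _]] := rmorphism_lift gen_t zt.
  apply: (unramified_at_adjoin (f := f) (k := 1%AS) (p_prime i) hw hK gen_t).
  exact: unramified_at_rat (p_prime i) hw.
have [h ha gen_a] := Qadj_spec (alpha l).
have [|f [fz _]] := rmorphism_lift (i := h) (j := j) (z := za l) gen_a.
  by rewrite ha hza // (ltn_trans li).
rewrite /= -fz; apply: (unramified_at_adjoin (f := f) (p_prime i) hw _ gen_a).
  by apply: unramified_ext_discriminant (p_prime i) _; exact: p_ndvd_disc.
by apply: IH => //; exact: ltnW.
Qed.

(** An element outside the stage is moved by some [g] fixing it. Written as [q.[za i]] with [q] over
    the stage, its image is the same [q] at another root of [D i], where the Eisenstein estimate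
    applies. *)
Lemma adjoin_chain_descent i (F : fieldExtType rat) (f : {rmorphism F -> N}) (x : F) :
    unramified_ext R (p i) K -> (i < m)%N ->
    f x \in adjoin_chain z za i.+1 -> f x \notin adjoin_chain z za i ->
  1 <= 2 * (p i)%:R `^ (- ((size (D i)).-1)%:R^-1) * height_in R x ^+ 2.
Proof.
move=> hK im xS xnS; set k := adjoin_chain z za i; set d := (size (D i)).-1.
have d0 : (0 < d)%N.
  by have := eisenstein_size_gt1 (D_eisenstein i); rewrite /d; case: (size _) => [|[]].
have [g gk gx] : exists2 g, g \in 'Gal({:N} / k)%g & g (f x) != f x.
  apply: contrapT => ng; case/negP: xnS; apply: mem_galois_fixed => g gk.
  by apply/eqP; apply: contrapT => /negP h; apply: ng; exists g.
have [w hw] := place_choice R N.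
have pR0 : 0 < (p i)%:R :> R by rewrite ltr0n prime_gt0.
apply: (conjugates_close_height hw (f := f) (g := g) (p_prime i)) => //.
- by rewrite powR_gt0.
- exact: (fintype.subsetP (galS _ (sub1v k))) gk.
move=> v hv; pose q := Fadjoin_poly k (za i) (f x).
have xq : f x = q.[za i] by rewrite /q Fadjoin_poly_eq.
have kq : q \is a polyOver k by exact: Fadjoin_polyOver.
have gxq : g (f x) = q.[g (za i)].
  by rewrite xq -horner_map (fixedPoly_gal (subvf k) gk kq).
rewrite gxq xq; have mD : D i \is monic by case: (D_eisenstein i).
set u := _ `^ _.
have u0 : 0 < u by rewrite powR_gt0.
have ud : u ^+ (size (D i)).-1 = (p i)%:R^-1.
  rewrite -powR_mulrn ?powR_ge0 // -powRrM mulNr mulVf ?pnatr_eq0 -?lt0n //.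
  by rewrite powRN powRr1 // ltW.
have ra := za_root im.
have rga : root (map_poly intr (D i)) (g (za i)).
  have -> : map_poly intr (D i) = map_poly (gal_rmorphism g) (map_poly intr (D i)).
    by rewrite -map_poly_comp; apply: eq_map_poly => b /=; rewrite rmorph_int.
  by rewrite -[g (za i)]/(gal_rmorphism g (za i)) fmorph_root.
apply: (eisenstein_conjugates_close (p_prime i) hv (D_eisenstein i) u0 ud (k := k)) => //.
- exact: unramified_at_chain.
- exact: (eisenstein_root_abs (p_prime i) hv (D_eisenstein i) u0 ud ra).
- exact: (eisenstein_root_abs (p_prime i) hv (D_eisenstein i) u0 ud rga).
apply: leq_trans (size_Fadjoin_poly _ _ _) _.
exact: adjoin_degree_root.
Qed.

End Tower.

Theorem theorem4 (R : realType)
    (K : fieldExtType rat) (iota : {rmorphism K -> algC})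
    (p : nat -> nat) (D : nat -> {poly int}) (alpha : nat -> algC)
    (p_prime : forall i, prime (p i))
    (D_eisenstein : forall i, eisenstein (p i) (D i))
    (alpha_root : forall i, root (map_poly intr (D i)) (alpha i))
    (p_ndvd_disc : forall i j, (j < i)%N ->
       ~~ ((p i)%:Z %| discriminant (Qadj (alpha j)))%Z)
    (p_root_cvg :
       ((p i)%:R : R) `^ (((size (D i)).-1)%:R)^-1 @[i --> \oo] --> +oo) :
  northcott R (generated_field (range iota `|` range alpha)).
Proof.
move=> X X0; have [t gen_t] := primitive_element_rat K.
have [B hB] : exists B, forall i, (B < p i)%N -> unramified_ext R (p i) K.
  have [N [j hj]] := splitting_field_exists [:: iota t].
  have [z zt] := hj _ (mem_head _ _).
  have [f _] := rmorphism_lift gen_t zt.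
  have [B hB] := unramified_ext_eventually R f.
  by exists B => i; exact: hB.
have [i0 hi0] : exists i0, forall i, (i0 <= i)%N -> unramified_ext R (p i) K /\
    2 * X ^+ 2 < (p i)%:R `^ (((size (D i)).-1)%:R)^-1.
  (* Since [p_i >= p_i^(1/d_i)], the one limit makes both the root exceed [2 X^2] and [p_i] exceed
     [B]. *)
  have /cvgryPgt/(_ (Num.max (2 * X ^+ 2) B%:R))[i0 _ h] := p_root_cvg.
  exists i0 => i /h /=; rewrite gt_max => /andP[-> hBi]; split=> //.
  apply: hB; rewrite -(ltr_nat R); apply: lt_le_trans hBi _.
  rewrite -[X in _ <= X]powRr1 ?ler0n // ler_powR ?ler1n ?prime_gt0 //.
  rewrite invf_le1 ?ler1n ?ltr0n //.
    by have := eisenstein_size_gt1 (D_eisenstein i); case: (size _) => [|[]].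
  by have := eisenstein_size_gt1 (D_eisenstein i); case: (size _) => [|[]].
(* The fields below depend on [a]; this bound for the degree of stage [i0] does not. *)
apply: sub_finite_set (finite_bounded_degree_height
  (\dim {:K} * \prod_(l < i0) (size (D l)).-1) X) => a [La ha]; split=> //.
have [m [im Lma]] := generated_field_stage i0 La.
have [N [j hj]] := splitting_field_exists (iota t :: [seq alpha i | i <- seq.iota 0 m]).
have [z zt] := hj _ (mem_head _ _).
have /choice[za hza'] i : exists x, (i < m)%N -> j x = alpha i.
  have [im'|mi] := ltnP i m; last by exists 0.
  have [|x jx] := hj (alpha i); last by exists x.
  by rewrite inE map_f ?orbT // mem_iota.
have hza i (im' : (i < m)%N) : j (za i) = alpha i := hza' i im'.
have [y /= ym ya] := adjoin_chain_generated gen_t zt hza Lma.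
have [h hxa gen_a] := Qadj_spec a.
have [|f [fx _]] := rmorphism_lift (i := h) (j := j) (z := y) gen_a.
  by rewrite ya hxa.
have H0 := height_in_ge0 R (Qadj_gen a).
(* An element lost at step [i] would satisfy [p_i^(1/d_i) <= 2 H^2 <= 2 X^2], against the choice of
   [i0]. *)
have descent i : (i0 <= i)%N -> (i < m)%N -> y \in adjoin_chain z za i.+1 ->
    y \in adjoin_chain z za i.
  move=> i0i im' yS; apply: contrapT => /negP yn.
  have [hK hp] := hi0 i i0i.
  rewrite -fx in yS yn.
  have := adjoin_chain_descent p_prime D_eisenstein alpha_root p_ndvd_disc
    gen_t zt hza hK im' yS yn.
  rewrite leNgt => /negP; apply.
  rewrite powRN mulrAC ltr_pdivrMr ?powR_gt0 ?ltr0n ?prime_gt0 // mul1r.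
  apply: le_lt_trans hp; rewrite ler_wpM2l // lerXn2r ?nnegrE // ltW //.
have y0 : y \in adjoin_chain z za i0.
  have key l : (l <= m - i0)%N -> y \in adjoin_chain z za (m - l).
    elim: l => [|l IH] lm; first by rewrite subn0.
    apply: descent; [lia|lia|].
    by rewrite -subSn ?subSS; [apply: IH; lia|lia].
  by have := key (m - i0)%N (leqnn _); rewrite subKn.
rewrite -(dim_Fadjoin_rmorph f gen_a) fx.
have : (<<1; y>> <= adjoin_chain z za i0)%VS.
  apply/FadjoinP; rewrite sub1v; split=> //.
move/dimvS/leq_trans; apply.
rewrite -(_ : \dim <<1; z>> = \dim {:K}).
  apply: dim_adjoin_chain => l li; split; first by case: (D_eisenstein l).
  apply: (za_root alpha_root hza); exact: leq_trans im.
have [g [<- _]] := rmorphism_lift gen_t zt.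
exact: dim_Fadjoin_rmorph.
Qed.
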